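(* There exists a universal constant $C>0$ such that the following holds for every $n\ge 1$ and all $a\in[0,1]$, $r\in[1,2]$ satisfying $r=2/(2-a)$ (in particular $C$ does not depend on $a$ or $n$). Put $c_r=\frac{1}{2\Gamma(1+1/r)}=\frac{r}{2\Gamma(1/r)}$. Then $$\mu_r(dx)=c_r^n\exp\bigl(-(|x_1|^r+|x_2|^r+\ldots+|x_n|^r)\bigr)\,dx_1dx_2\ldots dx_n$$ is a probability measure on $\mathbb{R}^n$ and $$E_{\mu_r}f^2-(E_{\mu_r}f^p)^{2/p}\le C(2-p)^aE_{\mu_r}\|\nabla f\|^2$$ for every smooth non-negative function $f$ on $\mathbb{R}^n$ and every $p\in[1,2)$.
   Context: $\|\cdot\|$ is the standard Euclidean norm on $\mathbb{R}^n$, and $E_{\mu_r}$ denotes expectation with respect to $\mu_r$. The expression $E_{\mu_r} f^2-(E_{\mu_r} f^p)^{2/p}$ is considered for functions $f$ that are square integrable with respect to $\mu_r$. *)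

(* Defs.v *)
From HB Require Import structures.
From mathcomp Require Import all_boot all_order all_algebra.
From mathcomp Require Import all_classical all_reals all_analysis.

Set Implicit Arguments.
Unset Strict Implicit.
Unset Printing Implicit Defensive.

Import Order.TTheory GRing.Theory Num.Theory.
Import numFieldNormedType.Exports.

Local Open Scope classical_set_scope.
Local Open Scope ring_scope.

(* R^n is the type 'rV[R]_n of row vectors, with the
   sigma-algebra generated by the n coordinate maps, as the library does for
   n.-tuple T; since R is second countable this is the Borel sigma-algebra. *)
Section measurable_rV.
Context {R : realType} (n : nat).

Let coord (i : 'I_n) (x : 'rV[R]_n) : R := x ord0 i.

Let rV_set0 : g_sigma_preimage coord set0.
Proof. exact: sigma_algebra0. Qed.

Let rV_setC A : g_sigma_preimage coord A -> g_sigma_preimage coord (~` A).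
Proof. exact: sigma_algebraC. Qed.

Let rV_bigcup (F : (set 'rV[R]_n)^nat) :
  (forall i, g_sigma_preimage coord (F i)) ->
  g_sigma_preimage coord (\bigcup_i F i).
Proof. exact: sigma_algebra_bigcup. Qed.

HB.instance Definition _ := @isMeasurable.Build default_measure_display
  'rV[R]_n (g_sigma_preimage coord) rV_set0 rV_setC rV_bigcup.

End measurable_rV.

Definition cons_rV {R : realType} {n : nat} (z : measurableTypeR R * 'rV[R]_n) :
  'rV[R]_n.+1 := row_mx (const_mx z.1 : 'M[R]_1) z.2.

Lemma cons_rV0 (R : realType) n (z : measurableTypeR R * 'rV[R]_n) :
  cons_rV z ord0 ord0 = z.1.
Proof.
rewrite /cons_rV (_ : ord0 = lshift n (ord0 : 'I_1)); last exact/val_inj.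
by rewrite (@row_mxEl _ 1 1 n) mxE.
Qed.

Lemma cons_rVS (R : realType) n (z : measurableTypeR R * 'rV[R]_n) i :
  cons_rV z ord0 (lift ord0 i) = z.2 ord0 i.
Proof.
rewrite /cons_rV (_ : lift ord0 i = rshift 1 i); last exact/val_inj.
by rewrite (@row_mxEr _ 1 1 n).
Qed.

Lemma measurable_coord_rV (R : realType) n (i : 'I_n) :
  measurable_fun setT (fun x : 'rV[R]_n => x ord0 i : measurableTypeR R).
Proof.
move=> _ Y mY; rewrite setTI; apply: sub_sigma_algebra => /=.
rewrite -bigcup_seq/=; exists i => /=; first by rewrite mem_index_enum.
by exists Y => //; rewrite setTI.
Qed.

Lemma measurable_rVP d (T : measurableType d) (R : realType) n
    (f : T -> 'rV[R]_n) :
  measurable_fun setT f <->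
  forall i, measurable_fun setT (fun t => f t ord0 i : measurableTypeR R).
Proof.
split=> [mf i|mf].
  exact: (measurableT_comp (@measurable_coord_rV _ _ i) mf).
move=> _ Y mY; rewrite setTI.
pose F (i : 'I_n) (x : 'rV[R]_n) : R := x ord0 i.
have : <<s \big[setU/set0]_(i < n) preimage_set_system setT (F i) measurable >>
    `<=` [set Y | measurable (f @^-1` Y)].
  apply: smallest_sub.
    split=> /=; first by rewrite preimage_set0.
    - by move=> A mA; rewrite setTD; exact: measurableC.
    - by move=> A mA; rewrite preimage_bigcup; exact: bigcupT_measurable.
  rewrite -bigcup_seq => A [i _ [B mB <-]] /=; rewrite setTI.
  by have := mf i measurableT B mB; rewrite setTI.
exact.
Qed.

Lemma measurable_cons_rV (R : realType) n : measurable_fun setT (@cons_rV R n).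
Proof.
apply/measurable_rVP => i; case: (unliftP ord0 i) => [j ->|->].
  under eq_fun do rewrite cons_rVS.
  exact: (measurableT_comp (@measurable_coord_rV _ _ j) measurable_snd).
by under eq_fun do rewrite cons_rV0; exact: measurable_fst.
Qed.

Section lebesgue_cons.
Local Open Scope ereal_scope.
Context {R : realType} {n : nat}.
Variable mu : {sigma_finite_measure set 'rV[R]_n -> \bar R}.

Definition lebesgue_cons : set 'rV[R]_n.+1 -> \bar R :=
  pushforward (@lebesgue_measure R \x mu) cons_rV.

Let mcons (A : set 'rV[R]_n.+1) :
  measurable A -> measurable (@cons_rV R n @^-1` A).
Proof.
by move=> mA; have := @measurable_cons_rV R n measurableT A mA; rewrite setTI.
Qed.

Let lebesgue_cons0 : lebesgue_cons set0 = 0.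
Proof. by rewrite /lebesgue_cons /pushforward preimage_set0 measure0. Qed.

Let lebesgue_cons_ge0 A : 0 <= lebesgue_cons A.
Proof. by rewrite /lebesgue_cons /pushforward measure_ge0. Qed.

Let lebesgue_cons_sigma_additive : semi_sigma_additive lebesgue_cons.
Proof.
move=> F mF tF mUF; rewrite /lebesgue_cons /pushforward preimage_bigcup.
apply: measure_semi_sigma_additive.
- by move=> k; exact: mcons.
- apply/trivIsetP => /= i j _ _ ij; rewrite -preimage_setI.
  by move/trivIsetP : tF => /(_ _ _ _ _ ij) ->//; rewrite preimage_set0.
- by rewrite -preimage_bigcup; exact: mcons.
Qed.

HB.instance Definition _ := isMeasure.Build _ _ _
  lebesgue_cons lebesgue_cons0 lebesgue_cons_ge0 lebesgue_cons_sigma_additive.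

Let uncons (x : 'rV[R]_n.+1) : measurableTypeR R * 'rV[R]_n :=
  (x ord0 ord0, \row_i x ord0 (lift ord0 i)).

Let measurable_uncons : measurable_fun setT uncons.
Proof.
apply/measurable_fun_pairP; split => /=; first exact: measurable_coord_rV.
apply/measurable_rVP => i; under eq_fun do rewrite /= mxE.
exact: measurable_coord_rV.
Qed.

Let cons_rVK : cancel cons_rV uncons.
Proof.
move=> z; rewrite /uncons cons_rV0 [RHS]surjective_pairing; congr pair.
by apply/rowP => i; rewrite mxE cons_rVS.
Qed.

Let lebesgue_cons_sigma_finite : sigma_finite setT lebesgue_cons.
Proof.
have /sigma_finiteP[F [TF ndF Foo]] := sigma_finiteT (@lebesgue_measure R).
have /sigma_finiteP[G [TG ndG Goo]] := sigma_finiteT mu.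
have mFG k : measurable (uncons @^-1` (F k `*` G k)).
  have mX : measurable (F k `*` G k).
    by apply: measurableX; [have [] := Foo k|have [] := Goo k].
  by have := measurable_uncons measurableT mX; rewrite setTI.
exists (fun k => uncons @^-1` (F k `*` G k)).
  rewrite -preimage_bigcup (_ : \bigcup_k _ = setT) ?preimage_setT//.
  apply/seteqP; split => // -[x y] _.
  have [i _ Fix] : (\bigcup_k F k) x by rewrite -TF.
  have [j _ Gjy] : (\bigcup_k G k) y by rewrite -TG.
  exists (maxn i j) => //; split => /=.
  - by move: x Fix; exact/subsetPset/ndF/leq_maxl.
  - by move: y Gjy; exact/subsetPset/ndG/leq_maxr.
move=> k; split => //; rewrite /lebesgue_cons /pushforward -comp_preimage.
rewrite (_ : uncons \o cons_rV = id); last exact/funext.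
have [mF Fk] := Foo k; have [mG Gk] := Goo k.
by rewrite preimage_id product_measure1E// lte_mul_pinfty// ge0_fin_numE.
Qed.

HB.instance Definition _ := Measure_isSigmaFinite.Build _ _ _
  lebesgue_cons lebesgue_cons_sigma_finite.

End lebesgue_cons.

Section lebesgue_rV0.
Context {R : realType}.

Definition lebesgue_rV0 : set 'rV[R]_0 -> \bar R := \d_(0 : 'rV[R]_0).

HB.instance Definition _ := Measure.on lebesgue_rV0.

Let lebesgue_rV0_fin : fin_num_fun lebesgue_rV0.
Proof. by move=> A mA; rewrite /lebesgue_rV0 diracE. Qed.

HB.instance Definition _ := Measure_isFinite.Build _ _ _
  lebesgue_rV0 lebesgue_rV0_fin.

End lebesgue_rV0.

(* n-fold product of one-dimensional Lebesgue measure: a Dirac mass on the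
   one-point space R^0, and the image of lambda \x lambda^n under
   R * R^n -> R^n.+1; see lebesgue_rV_box. *)
Fixpoint lebesgue_rV {R : realType} (n : nat) :
    {sigma_finite_measure set 'rV[R]_n -> \bar R} :=
  match n with
  | 0 => lebesgue_rV0
  | n'.+1 => lebesgue_cons (lebesgue_rV n')
  end.

Lemma lebesgue_rV_box (R : realType) n (A : 'I_n -> set (measurableTypeR R)) :
  (forall i, measurable (A i)) ->
  lebesgue_rV n [set x : 'rV[R]_n | forall i, A i (x ord0 i)] =
  (\prod_(i < n) lebesgue_measure (A i))%E.
Proof.
elim: n A => [|n IH] A mA.
  rewrite big_ord0 /= /lebesgue_rV0 diracE mem_set//.
  by move=> -[].
rewrite big_ord_recl -(IH (A \o lift ord0))//= /lebesgue_cons /pushforward.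
rewrite -product_measure1E//.
  congr product_measure1; apply/seteqP; split => -[a x] /=.
    move=> Ax; split; first by have := Ax ord0; rewrite cons_rV0.
    by move=> i; have := Ax (lift ord0 i); rewrite cons_rVS.
  move=> [Aa Ax] i; case: (unliftP ord0 i) => [j ->|->].
    by rewrite cons_rVS; exact: Ax.
  by rewrite cons_rV0.
rewrite (_ : mkset _ = \bigcap_(i in setT)
    ((fun x : 'rV[R]_n => x ord0 i) @^-1` A (lift ord0 i))).
  apply: fin_bigcap_measurable => [|i _]; first exact: finite_finset.
  by have := @measurable_coord_rV R n i measurableT _ (mA (lift ord0 i));
     rewrite setTI.
by apply/seteqP; split => [x Ax i _|x Ax i]; exact: Ax.
Qed.

Definition Gamma {R : realType} (s : R) : R :=
  \int[lebesgue_measure]_(t in `]0, +oo[) (t `^ (s - 1) * expR (- t)).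

Definition c_r {R : realType} (r : R) : R := (2 * Gamma (1 + r^-1))^-1.

Definition mu_r {R : realType} {n : nat} (r : R) : set 'rV[R]_n -> \bar R :=
  fun A => (\int[lebesgue_rV n]_(x in A)
    (c_r r ^+ n * expR (- \sum_(i < n) `|x ord0 i| `^ r))%:E)%E.

Definition partial {R : realType} {n : nat} (i : 'I_n) (f : 'rV[R]_n -> R) :
  'rV[R]_n -> R := 'D_(delta_mx ord0 i) f.

(* C^oo: the iterated partial derivatives of every order (s lists the
   directions, and s = [::] gives f itself) exist and are continuous. *)
Definition smooth {R : realType} {n : nat} (f : 'rV[R]_n -> R) : Prop :=
  forall s : seq 'I_n,
    continuous (foldr partial f s) /\
    forall i x, derivable (foldr partial f s) x (delta_mx ord0 i).

Definition gradient {R : realType} {n : nat} (f : 'rV[R]_n -> R)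
  (x : 'rV[R]_n) : 'rV[R]_n := \row_(i < n) partial i f x.

(* The library norm `|v| on 'rV[R]_n is the sup norm. *)
Definition enorm {R : realType} {n : nat} (v : 'rV[R]_n) : R :=
  Num.sqrt (\sum_(i < n) v ord0 i ^+ 2).

(* Main.v *)
(** The functional [E f^2 - (E f^p)^(2/p)] is the [Phi]-entropy of [f^p] for
    [Phi x = x^(2/p)].

    Being such an entropy with [1 < 2/p <= 2], it is subadditive over products,
    which reduces the inequality to the line.

    On the line it is at most [E (f^2 - c^2 - (2/p) c^(2-p) (f^p - c^p))] for
    every [c > 0].  With [s = 2 - p], the integrand is at most
    [2 (f - c)^2 min(1, s (1 + log^+ (f/c)))].  Take [c = |f|_2] and put
    [I = E f'^2 / c^2].  By AM-GM under the integral [f(x) - f(0) = int_0^x f'],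
    [log^+ (f/c)] is at most [O(W) + I] with [W = (1 + x^2)^(r/2) ~ 1 + |x|^r].
    As [min(1, t) <= t^a], the integrand is [O(s^a (f - c)^2 (W^a + I))].
    A Hardy inequality with weight [W^a = (1 + x^2)^(r-1)] bounds
    [E (f - c)^2 W^a] by [O(E f'^2)], and [E (f - c)^2 I <= 2 c^2 I = 2 E f'^2]. *)

Require Import Defs.
From HB Require Import structures.
From mathcomp Require Import all_boot all_order all_algebra.
From mathcomp Require Import all_classical all_reals all_analysis.
From mathcomp Require Import measurable_realfun ring lra.
Import Order.TTheory GRing.Theory Num.Theory.
Import numFieldNormedType.Exports.
Local Open Scope classical_set_scope.
Local Open Scope ring_scope.

Set Implicit Arguments.
Unset Strict Implicit.
Unset Printing Implicit Defensive.

(** * Inequalities for real powers *)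

Section real_inequalities.
Context {R : realType}.
Implicit Types x y u c p q s t : R.

(** The exponents meet in one identity: [r = 2 / (2 - a)] says [r / 2 * a = r - 1]. The power [a] of
    a logarithmic bound linear in [W] is therefore of the order of the squared derivative of the
    potential [|x|^r], the natural weight in a Hardy inequality.

    The potential [|x|^r] need not be smooth at 0. It lies between [W - 1] and [W], so using [W]
    instead costs a factor [e] in the density.

    The choice [c = |f|_2], rather than a mean or a median, makes both [E (f - c)^2 <= 2 c^2] and
    [|c - f 0| <= |f - f 0|_2] elementary. The second is what links [c] to the base point [f 0],
    from which the Hardy and the growth estimates start.

    Square integrability on the product passes only to almost every section, and the energy of the
    gradient may be infinite. Tensorisation is therefore carried out with extended integrals, and
    the real-valued argument is confined to the line with finite energy. *)

Lemma MVT_cc (f df : R -> R) (a b : R) : a < b ->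
  (forall x, a <= x <= b -> is_derive x 1 f (df x)) ->
  exists2 c, a < c < b & f b - f a = df c * (b - a).
Proof.
move=> ab dfE; have [||c cab ->] := @MVT R f df a b ab; last by exists c.
  by move=> x /[!in_itv]/= /andP[ax xb]; apply: dfE; rewrite !ltW.
apply: derivable_within_continuous => x /[!in_itv]/= xab.
by have [] := dfE x xab.
Qed.

(** Young's inequality for the product [x * 1] with exponent [p] and its conjugate. *)
Lemma powR_bernoulli x p : 0 <= x -> 1 <= p -> 1 + p * (x - 1) <= x `^ p.
Proof.
move=> x0; rewrite le_eqVlt => /predU1P[<-|p1]; first by rewrite powRr1//; lra.
have p0 : 0 < p by lra.
have q0 : 0 < (1 - p^-1)^-1 by rewrite invr_gt0 subr_gt0 invf_lt1.
have := conjugate_powR x0 ler01 p0 q0.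
rewrite invrK addrC subrK => /(_ erefl); rewrite mulr1 powR1 mul1r.
rewrite -(ler_pM2l p0) => H.
have -> : x `^ p = p * (x `^ p / p + (1 - p^-1)) - p + 1.
  by field; rewrite gt_eqF.
lra.
Qed.

(** The previous inequality for the base [x^k] and the exponent [1/k]. *)
Lemma powR_bernoulli_le x k : 0 <= x -> 0 <= k <= 1 -> x `^ k <= 1 + k * (x - 1).
Proof.
move=> x0 /andP[]; rewrite le_eqVlt => /predU1P[<-|k0 k1].
  by rewrite powRr0; lra.
have := @powR_bernoulli (x `^ k) k^-1 (powR_ge0 _ _).
rewrite invf_ge1// => /(_ k1); rewrite -powRrM divff ?gt_eqF// powRr1// => H.
have : k * (1 + k^-1 * (x `^ k - 1)) <= k * x by rewrite ler_pM2l.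
by rewrite mulrDr mulrA divff ?gt_eqF// mul1r; lra.
Qed.

Lemma powR_tangent x c q : 0 <= x -> 0 <= c -> 1 <= q ->
  c `^ q + q * c `^ (q - 1) * (x - c) <= x `^ q.
Proof.
move=> x0; rewrite le_eqVlt => /predU1P[<-|c0] q1.
  move: q1; rewrite le_eqVlt => /predU1P[<-|q1].
    by rewrite subrr powRr0 !powRr1//; lra.
  by rewrite !powR0 ?gt_eqF//; [rewrite mulr0 mul0r addr0 powR_ge0|lra|lra].
have := @powR_bernoulli (x / c) q.
rewrite divr_ge0// ?(ltW c0)// => /(_ isT q1).
rewrite -(ler_pM2l (powR_gt0 q c0)) -powRM ?divr_ge0 ?(ltW c0)//.
have -> : c * (x / c) = x by field; rewrite gt_eqF.
apply: le_trans; rewrite -(@mulr_powRB1 _ c q (ltW c0)); last by lra.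
by rewrite le_eqVlt; apply/orP; left; apply/eqP; field; rewrite gt_eqF.
Qed.

Lemma powRB1_ge x s : 0 < x -> x * (1 - s * ln x) <= x `^ (1 - s).
Proof.
move=> x0; rewrite powRD; last by rewrite (gt_eqF x0) implybT.
rewrite powRr1 ?(ltW x0)// ler_pM2l//.
by rewrite /powR gt_eqF//; have := expR_ge1Dx (- s * ln x); lra.
Qed.

Definition logp (x : R) : R := ln (Num.max 1 x).

Lemma logp_ge0 x : 0 <= logp x.
Proof. by rewrite ln_ge0// le_max lexx. Qed.

(* [bregman p u] is the Bregman divergence of [x |-> x^(2/p)] between [u^p] and
   [1]. *)
Definition bregman (p u : R) : R := u ^+ 2 - 1 - 2 / p * (u `^ p - 1).

Lemma bregman_le_sqr p u : 1 <= p -> 0 <= u -> bregman p u <= (u - 1) ^+ 2.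
Proof.
move=> p1 u0; have p0 : 0 < p by lra.
have := powR_bernoulli u0 p1; rewrite -subr_ge0 => H.
have : 0 <= 2 / p * (u `^ p - (1 + p * (u - 1))) by rewrite mulr_ge0// divr_ge0// ltW.
rewrite [X in 0 <= X](_ : _ = 2 / p * (u `^ p - 1) - 2 * (u - 1)); last first.
  by field; rewrite gt_eqF.
by rewrite /bregman expr2 expr2; nra.
Qed.

Lemma is_derive_bregman p u : 1 <= p -> 0 < u ->
  is_derive u 1 (bregman p) (2 * u - 2 * u `^ (p - 1)).
Proof.
move=> p1 u0; rewrite /bregman.
have d := @is_derive1_powR _ p u u0.
apply: is_derive_eq; rewrite /GRing.scale/=; field; lra.
Qed.

(** The divergence vanishes at 1, so the mean value theorem gives one factor [u - 1]; the derivative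
    [2 x - 2 x^(p-1)] gives the other. Above 1, [x^(p-1) >= x (1 - (2 - p) ln x)], and
    [u ln u <= (u - 1) (1 + ln u)]. Below 1, the concavity of [x^(p-1)] suffices. The point [u = 0],
    where the power is not differentiated, is computed directly. *)
Lemma bregman_le_log p u : 1 <= p < 2 -> 0 <= u ->
  bregman p u <= 2 * ((2 - p) * (1 + logp u)) * (u - 1) ^+ 2.
Proof.
move=> /andP[p1 p2]; rewrite le_eqVlt => /predU1P[<-|u0].
  have L := logp_ge0 0; rewrite /bregman powR0; last by rewrite gt_eqF; lra.
  rewrite expr0n/= !sub0r sqrrN expr1n mulr1.
  have -> : -1 - 2 / p * -1 = (2 - p) / p by field; lra.
  apply: (@le_trans _ _ (2 - p)); last by nra.
  by rewrite ler_pdivrMr; nra.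
have L := logp_ge0 u.
case: (ltgtP u 1) => [u1|u1|->]; last first.
- by rewrite /bregman powR1 !subrr expr1n subrr expr0n/= !mulr0 subr0.
- have [x xu fE] := @MVT_cc (bregman p) _ 1 u u1
    (fun x H => is_derive_bregman p1 (lt_le_trans ltr01 (proj1 (andP H)))).
  have -> : bregman p u = bregman p u - bregman p 1.
    by rewrite [in X in _ = _ - X]/bregman powR1 expr1n !subrr mulr0 !subr0.
  rewrite fE; move: xu => /andP[x1 xu].
  have x0 : 0 < x by lra.
  have := @powRB1_ge x (2 - p) x0; rewrite (_ : 1 - (2 - p) = p - 1); last by ring.
  have lx : 0 <= ln x by rewrite ln_ge0// ltW.
  have lxu : ln x <= ln u by rewrite ler_ln ?posrE// ltW.
  have lu : ln u <= u - 1 by have := @le_ln1Dx R (u - 1); rewrite (addrC 1) subrK; apply; lra.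
  have -> : logp u = ln u by rewrite /logp max_r// ltW.
  move=> H.
  have H2 : x * ln x <= u * ln u by rewrite ler_pM// ltW.
  have H3 : u * ln u <= (u - 1) * (1 + ln u) by nra.
  have H4 : 2 * x - 2 * x `^ (p - 1) <= 2 * ((2 - p) * ((u - 1) * (1 + ln u))).
    have : (2 - p) * (x * ln x) <= (2 - p) * ((u - 1) * (1 + ln u)).
      by rewrite ler_pM2l; lra.
    by lra.
  apply: (@le_trans _ _ (2 * ((2 - p) * ((u - 1) * (1 + ln u))) * (u - 1))).
    by rewrite ler_pM2r; lra.
  by rewrite le_eqVlt; apply/orP; left; apply/eqP; ring.
- have [x xu fE] := @MVT_cc (bregman p) _ u 1 u1
    (fun x H => is_derive_bregman p1 (lt_le_trans u0 (proj1 (andP H)))).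
  have -> : bregman p u = - (bregman p 1 - bregman p u).
    by rewrite [in X in _ = - (X - _)]/bregman powR1 expr1n !subrr mulr0 subr0 sub0r opprK.
  rewrite fE; move: xu => /andP[ux x1].
  have := @powR_bernoulli_le x (p - 1) (ltW (lt_trans u0 ux)).
  have -> : 0 <= p - 1 <= 1 by lra.
  move=> /(_ isT) H.
  have H4 : - (2 * x - 2 * x `^ (p - 1)) <= 2 * (2 - p) * (1 - u).
    have : (2 - p) * (1 - x) <= (2 - p) * (1 - u) by rewrite ler_pM2l; lra.
    by lra.
  apply: (@le_trans _ _ (2 * (2 - p) * (1 - u) * (1 - u))).
    by rewrite -mulNr ler_pM2r; lra.
  rewrite (_ : (u - 1) ^+ 2 = (1 - u) * (1 - u)); last by ring.
  have : 0 <= (2 - p) * (1 - u) * (1 - u) * logp u by rewrite !mulr_ge0//; lra.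
  by lra.
Qed.

Lemma minr_le_powR a t : 0 <= a <= 1 -> 0 <= t -> Num.min 1 t <= t `^ a.
Proof.
move=> /andP[a0 a1]; rewrite le_eqVlt => /predU1P[<-|t0].
  by rewrite min_r ?powR_ge0.
have [t1|t1] := leP 1 t.
  by have := ler_powR t1 a0; rewrite powRr0.
by rewrite ger1_powR// t0 ltW.
Qed.


(** Both tangent inequalities are taken at the barycentre [m], so the linear terms cancel. *)
Lemma powR_convex2 w x y q : 0 <= w <= 1 -> 0 <= x -> 0 <= y -> 1 <= q ->
  (w * x + (1 - w) * y) `^ q <= w * x `^ q + (1 - w) * y `^ q.
Proof.
move=> /andP[w0 w1] x0 y0 q1; set m := w * x + _.
have m0 : 0 <= m by rewrite addr_ge0// mulr_ge0//; lra.
have Hx := powR_tangent x0 m0 q1; have Hy := powR_tangent y0 m0 q1.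
have := lerD (ler_wpM2l w0 Hx) (ler_wpM2l (_ : 0 <= 1 - w) Hy).
move=> /(_ ltac:(lra)); apply: le_trans.
set t := q * _; rewrite le_eqVlt; apply/orP; left; apply/eqP; rewrite /m; ring.
Qed.

Lemma continuous_powR q x : 0 < x -> {for x, continuous (fun y : R => y `^ q)}.
Proof.
move=> x0; apply/differentiable_continuous/derivable1_diffP.
by have [] := @is_derive1_powR _ q x x0.
Qed.

(** Truncation at 0 shields against the default value of [powR] at negative bases, which would break
    continuity at 0. *)
Lemma continuous_powR_max q : 0 < q -> continuous (fun x => Num.max 0 x `^ q).
Proof.
move=> q0 x; have [x0|x0|->] := ltgtP x 0.
- rewrite /continuous_at max_l ?ltW// powR0 ?gt_eqF//; apply: cvg_near_cst.
  near=> y; rewrite max_l ?powR0 ?gt_eqF// ltW//.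
  by near: y; exact: lt_nbhsl.
- have := @continuous_powR q _ x0.
  rewrite /continuous_at max_r ?ltW//; apply: cvg_trans; apply: near_eq_cvg.
  by near=> y; rewrite max_r// ltW//; near: y; exact: lt_nbhsr.
apply/left_right_continuousP; rewrite maxxx powR0 ?gt_eqF//; split.
  apply: cvg_near_cst; near=> y; rewrite max_l ?powR0 ?gt_eqF//.
apply: cvg_trans (powR_cvg0 q0); apply: near_eq_cvg.
by near=> y; rewrite max_r.
Unshelve. all: by end_near. Qed.

(** In [al] the difference of the two sides vanishes at 1, and its derivative is [(1 + th) * S]. The
    sign of [S x] is that of [x - 1], by convexity of the power [th]: for [x >= 1],
    [(x + be - 1) / x] lies between [be] and 1 with weight [1/x]; for [x <= 1], [be] lies between
    [(x + be - 1) / x] and 1 with weight [x]. *)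
Lemma powR_four_point_dual (al be th : R) : 0 <= al -> 0 <= be -> 1 <= th ->
  0 <= al + be - 1 ->
  (al + be - 1) `^ (1 + th) <= al `^ (1 + th) + be `^ (1 + th) - 1
    + (1 + th) / th * (al `^ th - 1) * (be `^ th - 1).
Proof.
move=> al0 be0 th1 s0.
have th0 : 0 < th by lra.
have e0 : 0 < 1 + th by lra.
(* The truncated powers keep [f] continuous up to the end point [al], where [al] or [al + be - 1]
   may be 0; derivatives are taken only at interior points, where both bases are positive. *)
pose N (x : R) := Num.max 0 x `^ (1 + th).
pose N' (x : R) := Num.max 0 x `^ th.
pose k := (1 + th) / th * (be `^ th - 1).
pose f x := N x + be `^ (1 + th) - 1 + k * (N' x - 1) - N (x + be - 1).
pose S x := x `^ th + x `^ (th - 1) * (be `^ th - 1) - (x + be - 1) `^ th.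
have fE x : 0 <= x -> 0 <= x + be - 1 -> f x = x `^ (1 + th) + be `^ (1 + th) - 1
    + k * (x `^ th - 1) - (x + be - 1) `^ (1 + th).
  by move=> x0 y0; rewrite /f /N /N' !max_r.
have f1 : f 1 = 0.
  rewrite fE//; last lra.
  by rewrite !powR1 (_ : 1 + be - 1 = be); [ring|ring].
have : 0 <= f al; last first.
  rewrite fE// /k; set A := _ `^ _; set B := be `^ (_ + _); set C := al `^ th.
  set D := be `^ th; set E := (al + _ - _) `^ _; set K := _ / _.
  by rewrite [K * _ * (C - 1)](_ : _ = K * (C - 1) * (D - 1)); [lra|ring].
have Sx x : 0 < x -> x * S x = x * x `^ th - x * (x + be - 1) `^ th + x `^ th * (be `^ th - 1).
  move=> x0; rewrite /S -(@mulr_powRB1 _ x th (ltW x0) th0); ring.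
have Sge x : 1 <= x -> 0 <= S x.
  move=> x1; have x0 : 0 < x by lra.
  rewrite -(pmulr_rge0 _ x0) Sx//.
  have w01 : 0 <= x^-1 <= 1 by rewrite invr_ge0 invf_le1// x1 ltW.
  have := @powR_convex2 _ be 1 _ w01 be0 ler01 th1.
  rewrite powR1 -(ler_pM2l (powR_gt0 th x0)) -powRM//; [|lra|]; last first.
    by rewrite addr_ge0// mulr_ge0//; lra.
  rewrite [x * (_ + _)](_ : _ = x + be - 1); last by field; rewrite gt_eqF.
  rewrite -(ler_pM2l x0) => H.
  have E : x * (x `^ th * (x^-1 * be `^ th + (1 - x^-1) * 1)) =
    x `^ th * (be `^ th + x - 1) by field; rewrite gt_eqF.
  rewrite E in H; lra.
have Sle x : 0 < x <= 1 -> 0 < x + be - 1 -> S x <= 0.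
  move=> /andP[x0 x1] y0.
  rewrite -(pmulr_rle0 _ x0) Sx//.
  have m0 : 0 <= (x + be - 1) / x by rewrite divr_ge0// ltW.
  have x01 : 0 <= x <= 1 by rewrite x1 ltW.
  have := @powR_convex2 _ ((x + be - 1) / x) 1 _ x01 m0 ler01 th1.
  rewrite (_ : x * ((x + be - 1) / x) + (1 - x) * 1 = be); last by field; rewrite gt_eqF.
  rewrite powR1 => /(ler_wpM2l (powR_ge0 x th)) H.
  have E : x `^ th * (x * ((x + be - 1) / x) `^ th + (1 - x) * 1) =
    x * (x + be - 1) `^ th + x `^ th * (1 - x).
    have {2}-> : x + be - 1 = x * ((x + be - 1) / x) by field; rewrite gt_eqF.
    by rewrite [in RHS]powRM// ?(ltW x0)//; ring.
  rewrite E in H; lra.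
have Nd x q : 0 < x -> 0 < q ->
    is_derive x 1 (fun y : R => Num.max 0 y `^ q) (q * x `^ (q - 1)).
  move=> x0 q0; apply: (@near_eq_is_derive _ R^o R^o (fun y : R => y `^ q)).
    by near=> y; rewrite max_r// ltW//; near: y; exact: lt_nbhsr.
  exact: is_derive1_powR.
have fd x : 0 < x -> 0 < x + be - 1 -> is_derive x 1 f ((1 + th) * S x).
  move=> x0 y0.
  have d1 := Nd x _ x0 e0.
  have d2 := Nd x _ x0 th0.
  have d3 := Nd _ _ y0 e0.
  have d4 : is_derive x 1 (fun x => x + be - 1) 1.
    by apply: is_derive_eq; rewrite oppr0 !addr0.
  have d5 := @is_derive1_comp _ _ (fun x => x + be - 1) _ _ _ d3 d4.
  rewrite /f; apply: is_derive_eq; rewrite /S /GRing.scale/= /k.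
  rewrite (_ : 1 + th - 1 = th); last by ring.
  by field; rewrite gt_eqF.
have cf : continuous f.
  have c1 := continuous_powR_max e0.
  have c2 := continuous_powR_max th0.
  move=> x; rewrite /f; apply: cvgB; last first.
    apply: (@continuous_comp R^o R^o R^o (fun x => x + be - 1) (fun y => Num.max 0 y `^ (1 + th))); last exact: c1.
    by apply: cvgB; [apply: cvgD; [exact: cvg_id|exact: cvg_cst]|exact: cvg_cst].
  apply: cvgD; last first.
    by apply: cvgM; [exact: cvg_cst|apply: cvgB; [exact: c2|exact: cvg_cst]].
  by apply: cvgB; [apply: cvgD; [exact: c1|exact: cvg_cst]|exact: cvg_cst].
have [al1|al1|->] := ltgtP al 1; last by rewrite f1.
- have [||c] := @MVT _ f (fun x => (1 + th) * S x) al 1 al1.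
  + by move=> x /[!in_itv]/= /andP[x0 x1]; apply: fd; lra.
  + exact: continuous_subspaceT.
  rewrite in_itv/= => /andP[c0 c1]; rewrite f1 sub0r => H.
  have : S c <= 0 by apply: Sle; lra.
  move=> Sc; rewrite -oppr_le0 H -mulrA mulr_ge0_le0 ?mulr_le0_ge0//; lra || nra.
- have [||c] := @MVT _ f (fun x => (1 + th) * S x) 1 al al1.
  + by move=> x /[!in_itv]/= /andP[x0 x1]; apply: fd; lra.
  + exact: continuous_subspaceT.
  rewrite in_itv/= => /andP[c0 c1]; rewrite f1 subr0 => ->.
  by rewrite !mulr_ge0//; [lra|apply: Sge; lra|lra].
Unshelve. all: by end_near. Qed.

(* Integrated over a product space, with [A] and [B] the partial means of [G]
   and [1] its mean, this is the subadditivity of [E G^q - (E G)^q].  Young's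
   inequality eliminates [G]. *)
Lemma powR_four_point q (G A B : R) : 1 < q <= 2 -> 0 <= G -> 0 <= A -> 0 <= B ->
  q * A `^ (q - 1) * G + q * B `^ (q - 1) * G + (q - 1) + q * (q - 1) * (A + B)
  <= G `^ q + (q - 1) * A `^ q + (q - 1) * B `^ q + q * G + q * (q - 1) * (A * B)
     + q * (q - 1).
Proof.
move=> /andP[q1 q2] G0 A0 B0.
have k0 : 0 < q - 1 by lra.
set al := A `^ (q - 1); set be := B `^ (q - 1).
have al0 : 0 <= al by exact: powR_ge0.
have be0 : 0 <= be by exact: powR_ge0.
(* The conjugate exponent of [q] is [1 + th]; [q <= 2] makes [th >= 1]. *)
pose th := (q - 1)^-1.
have th1 : 1 <= th by rewrite invf_ge1//; lra.
have th0 : 0 < th by lra.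
have thq : 1 + th = q / (q - 1) by rewrite /th; field; lra.
have powth x : 0 <= x -> (x `^ (q - 1)) `^ th = x.
  by move=> x0; rewrite -powRrM divff ?gt_eqF// powRr1.
have powe x : 0 <= x -> (x `^ (q - 1)) `^ (1 + th) = x `^ q.
  by move=> x0; rewrite -powRrM thq; congr (_ `^ _); field; lra.
have kth : (1 + th) / th = q by rewrite thq /th; field; lra.
have dual x y : 0 <= x -> 0 <= y -> 0 <= x `^ (q - 1) + y `^ (q - 1) - 1 ->
  (x `^ (q - 1) + y `^ (q - 1) - 1) `^ (1 + th) <=
  x `^ q + y `^ q - 1 + q * (x - 1) * (y - 1).
  move=> x0 y0 /(@powR_four_point_dual _ _ th (powR_ge0 _ _) (powR_ge0 _ _) th1).
  by rewrite !powe// !powth// kth.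
(* Up to the factor [q], [al + be - 1] is the net coefficient of [G]. If it is nonnegative, Young's
   inequality trades [G * sg] for [G^q] and a power of [sg], which the dual inequality bounds. *)
have [s0|s0] := leP 0 (al + be - 1).
  have H := dual _ _ A0 B0 s0; set sg := al + be - 1 in s0 H.
  have e0 : 0 < 1 + th by lra.
  have qq : q^-1 + (1 + th)^-1 = 1 by rewrite thq; field; lra.
  have := conjugate_powR G0 s0 (_ : 0 < q) e0 qq => /(_ ltac:(lra)).
  have q0 : 0 < q by lra.
  rewrite -(ler_pM2l q0) thq.
  rewrite [q * (_ + _)](_ : _ = G `^ q + (q - 1) * sg `^ (q / (q - 1))); last first.
    field; lra.
  rewrite -thq => H2.
  have : (q - 1) * sg `^ (1 + th) <= (q - 1) * (A `^ q + B `^ q - 1 + q * (A - 1) * (B - 1)).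
    by rewrite ler_pM2l.
  have -> : q * al * G + q * be * G = q * (G * sg) + q * G by rewrite /sg; ring.
  lra.
(* The coefficient of [G] is now negative, so the terms in [G] help and only
   [A^q + B^q - 1 + q (A - 1) (B - 1) >= 0] is at stake. At [A'], where [A'^(q-1) + B^(q-1) = 1],
   this is the dual inequality with left side 0. The tangent at [A'] carries it down to [A], thanks
   to [B <= B^(q-1)]. *)
pose A' := (1 - be) `^ th.
have be1 : be < 1 by lra.
have A'0 : 0 <= A' by exact: powR_ge0.
have A'E : A' `^ (q - 1) = 1 - be.
  by rewrite -powRrM mulVf ?gt_eqF// powRr1//; lra.
have AA' : A <= A'.
  rewrite -(powth A A0); apply: ge0_ler_powR; rewrite ?nnegrE -?/al//; lra.
have := dual A' B A'0 B0; rewrite A'E -/be (_ : 1 - be + be - 1 = 0); last by ring.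
rewrite lexx powR0 ?gt_eqF//; last lra.
move=> /(_ isT) H.
have T := powR_tangent A0 A'0 (ltW q1); rewrite A'E in T.
have B1 : B <= 1.
  rewrite leNgt; apply/negP => B1.
  have : 1 `^ (q - 1) <= be by apply: ge0_ler_powR; rewrite ?nnegrE//; lra.
  by rewrite powR1; lra.
have Bbe : B <= be.
  have [->|Bn0] := eqVneq B 0; first exact: powR_ge0.
  by apply: ger1_powR; [rewrite lt_neqAle eq_sym Bn0 B0|lra].
have H2 : 0 <= A `^ q + B `^ q - 1 + q * (A - 1) * (B - 1).
  have : 0 <= q * (A' - A) * (be - B) by rewrite !mulr_ge0//; lra.
  nra.
have G1 : q * al * G + q * be * G <= q * G.
  have : 0 <= q * G * (1 - al - be) by rewrite !mulr_ge0//; lra.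
  lra.
have Gq := powR_ge0 G q.
have := mulr_ge0 (ltW k0) H2.
lra.
Qed.

End real_inequalities.

(** * Gamma integrals *)

Section gamma.
Context {R : realType}.
Notation mu := (@lebesgue_measure R).
Local Open Scope ereal_scope.

Lemma integral_expR_tail (k V : R) : (0 < k)%R ->
  \int[mu]_(x in `]V, +oo[) (k * expR (- (k * x)))%:E = (expR (- (k * V)))%:E.
Proof.
move=> k0; pose F (x : R) := (- expR (- (k * x)))%R.
have dF (x : R) : is_derive x 1%R F (k * expR (- (k * x)))%R.
  by rewrite /F; apply: is_derive_eq; rewrite /GRing.scale/=; ring.
have cF (x : R) : {for x, continuous F}.
  apply/differentiable_continuous/derivable1_diffP.
  by have [] := dF x.
have cf : continuous (fun x : R => k * expR (- (k * x)))%R.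
  move=> x; apply: cvgM; first exact: cvg_cst.
  apply: (@continuous_comp R^o R^o R^o (fun x => - (k * x))%R expR).
    by apply: cvgN; apply: cvgM; [exact: cvg_cst|exact: cvg_id].
  exact: continuous_expR.
rewrite integral_itv_obnd_cbnd; last first.
  by apply: measurable_funTS; apply/measurable_EFinP; exact: continuous_measurable_fun.
rewrite (@ge0_continuous_FTC2y _ _ F V 0%R).
- by rewrite /F sub0e EFinN oppeK.
- by move=> x _; rewrite mulr_ge0 ?expR_ge0// ltW.
- exact: continuous_subspaceT.
- rewrite /F -oppr0; apply: cvgN.
  apply: (@cvg_comp _ _ _ (fun x : R => k * x)%R (fun x => expR (- x)) _ (@pinfty_nbhs R)).
    exact: gt0_cvgMry.
  exact: cvgr_expR.
- by move=> x _; have [] := dF x.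
- by apply: cvg_at_right_filter; exact: cF.
- by move=> x _; rewrite derive1E; have [_] := dF x.
Qed.

(** [exp (- phi t)] is the integral of [exp (- s)] over [s > phi t]; Tonelli exchanges the two
    integrals. This stands in for both integration by parts and the substitution [s = t^r] in the
    gamma integrals below. *)
Lemma layer_cake_expR (D : set R) (w phi : R -> R) : measurable D ->
  measurable_fun setT w -> measurable_fun setT phi ->
  (forall t, D t -> 0 <= w t)%R -> (forall t, D t -> 0 <= phi t)%R ->
  \int[mu]_(t in D) (w t * expR (- phi t))%:E =
  \int[mu]_(s in `]0%R, +oo[)
    ((\int[mu]_(t in D `&` [set t | (phi t < s)%R]) (w t)%:E) * (expR (- s))%:E).
Proof.
move=> mD mw mphi w0 phi0.
have mE : measurable_fun [set: R] (fun s => expR (- s) : R)%R.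
  by apply: measurableT_comp => //; exact: measurableT_comp.
pose A := [set z : measurableTypeR R * measurableTypeR R | D z.1 /\ (phi z.1 < z.2)%R].
have mA : measurable A.
  have m1 : measurable_fun setT (fun z : measurableTypeR R * measurableTypeR R => phi z.1).
    exact: (measurableT_comp mphi).
  have := measurable_fun_ltr m1 (@measurable_snd _ _ (measurableTypeR R) (measurableTypeR R)).
  move=> /(_ measurableT [set true] I); rewrite setTI => m2.
  have m3 : measurable ((@fst R R) @^-1` D).
    by rewrite -[X in measurable X]setTI; exact: measurable_fst.
  by apply: (eq_ind _ measurable (measurableI _ _ m3 m2)).
pose H := ((fun z : measurableTypeR R * measurableTypeR R => (w z.1 * expR (- z.2))%:E) \_ A).
have H0 z : 0 <= H z.
  rewrite /H patchE; case: ifPn => // /[!inE] -[Dz _].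
  by rewrite lee_fin mulr_ge0// ?w0// expR_ge0.
have mH : measurable_fun setT H.
  apply/(measurable_restrictT _ mA)/measurable_EFinP/measurable_funTS.
  apply: measurable_funM.
    exact: (measurableT_comp mw).
  exact: (measurableT_comp mE).
have mDs s : measurable (D `&` [set t | (phi t < s)%R]).
  apply: measurableI => //.
  have := measurable_fun_ltr mphi (measurable_cst s).
  by move=> /(_ measurableT [set true] I); rewrite setTI.
transitivity (\int[mu]_t \int[mu]_s H (t, s)).
  rewrite integral_mkcond; apply: eq_integral => t _; rewrite patchE.
  case: ifPn => [/[!inE] Dt|/negP tD].
    transitivity (\int[mu]_(s in `]phi t, +oo[) ((w t)%:E * (expR (- s))%:E)).
      rewrite ge0_integralZl//.
      - have := integral_expR_tail (phi t) ltr01; rewrite mul1r EFinM => <-.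
        by congr *%E; apply: eq_integral => s _; rewrite !mul1r.
      - by apply/measurable_EFinP/measurable_funTS.
      - by rewrite lee_fin w0.
    rewrite integral_mkcond; apply: eq_integral => s _; rewrite /H !patchE.
    congr (if _ then _ else _); apply/idP/idP; rewrite !inE /A/= in_itv/= andbT//.
    by case.
  rewrite integral0_eq// => s _; rewrite /H patchE ifN//.
  by apply/negP => /[!inE] -[/= Dt]; move: tD; rewrite inE.
rewrite (fubini_tonelli _ mH H0) [RHS]integral_mkcond.
apply: eq_integral => s _; rewrite patchE; case: ifPn => [/[!inE]/= s0|s0].
  rewrite -ge0_integralZr//; last 3 first.
  - exact: mDs.
  - by apply: measurable_funTS; exact/measurable_EFinP.
  - by move=> t [Dt _]; rewrite lee_fin w0.
  rewrite [RHS]integral_mkcond; apply: eq_integral => t _; rewrite /H !patchE.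
  congr (if _ then _ else _).
rewrite integral0_eq// => t _; rewrite /H patchE ifN//.
apply: contra s0 => /[!inE] -[/= Dt ts]; rewrite in_itv/= andbT.
by rewrite (le_lt_trans _ ts)// phi0.
Qed.

(** For [x < 1] the integrand is unbounded at 0, so the fundamental theorem is applied on [[a n, s]]
    and [a n] is sent to 0. The factor [s / 2] keeps [a n < s] already for [n = 0]. *)
Lemma integral_powR (x s : R) : (0 < x)%R -> (0 < s)%R ->
  \int[mu]_(t in `]0%R, s[) (x * t `^ (x - 1))%:E = (s `^ x)%:E.
Proof.
move=> x0 s0; pose a n : R := (s / 2 * n.+1%:R^-1)%R.
have a0 n : (0 < a n)%R by rewrite mulr_gt0// ?divr_gt0// invr_gt0.
have as_ n : (a n < s)%R.
  apply: (@le_lt_trans _ _ (s / 2)%R); last by lra.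
  by rewrite ler_piMr ?divr_ge0 ?(ltW s0)// invf_le1// ler1n.
have dP (t : R) : (0 < t)%R -> is_derive t 1%R (fun t : R => t `^ x)%R (x * t `^ (x - 1))%R.
  exact: is_derive1_powR.
have dQ (t : R) : (0 < t)%R -> {for t, continuous (fun t : R => x * t `^ (x - 1))%R}.
  by move=> t0; apply: cvgM; [exact: cvg_cst|exact: continuous_powR].
have mf (D : set R) : measurable_fun D (fun t => (x * t `^ (x - 1))%:E).
  by apply: measurable_funTS; apply/measurable_EFinP; apply: measurable_funM.
have Ua : \bigcup_n `[a n, s]%classic = `]0%R, s]%classic.
  apply/seteqP; split=> [t [n _]|t] /=; rewrite !in_itv/=.
    by move=> /andP[ant ->]; rewrite (lt_le_trans (a0 n) ant).
  move=> /andP[t0 ts]; exists (Num.truncn (s / t)) => //=.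
  rewrite in_itv/= ts andbT /a.
  rewrite ler_pdivrMr// (le_trans (_ : _ <= s)%R)//; first by lra.
  rewrite mulrC -ler_pdivrMr// ltW// truncnS_gt//.
have ndF : nondecreasing_seq (fun n => `[a n, s]%classic).
  apply/nondecreasing_seqP => n; rewrite subsetEset => t /=.
  rewrite !in_itv/= => /andP[ant ->]; rewrite andbT (le_trans _ ant)//.
  by rewrite /a ler_pM2l ?divr_gt0// lef_pV2 ?posrE// ler_nat.
rewrite integral_itv_bndo_bndc// -Ua.
have /cvg_lim <- // := @ge0_nondecreasing_set_cvg_integral _ (measurableTypeR R) _
  (fun n => `[a n, s]%classic) (fun t => (x * t `^ (x - 1))%:E) mu ndF
  (fun n => measurable_itv _) (fun n => mf _)
  (fun n t _ => mulr_ge0 (ltW x0) (powR_ge0 _ _)).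
apply/cvg_lim => //.
have -> : (fun n => \int[mu]_(t in `[a n, s]) (x * t `^ (x - 1))%:E) =
    (fun n => (s `^ x - (Num.max 0 (a n)) `^ x)%:E)%R.
  apply/funext => n; rewrite max_r ?(ltW (a0 n))//.
  rewrite (@continuous_FTC2 _ _ (fun t : R => t `^ x)%R) ?EFinB//.
  - apply/continuous_within_itvP => //; split.
    + by move=> t /[!in_itv]/= /andP[t0 _]; apply: dQ; exact: lt_trans t0.
    + by apply: cvg_at_right_filter; exact: dQ.
    + by apply: cvg_at_left_filter; exact: dQ.
  - split.
    + by move=> t /[!in_itv]/= /andP[t0 _]; have [] := dP t (lt_trans (a0 n) t0).
    + by apply: cvg_at_right_filter; exact: continuous_powR.
    + by apply: cvg_at_left_filter; exact: continuous_powR.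
  - move=> t /[!in_itv]/= /andP[t0 _]; rewrite derive1E.
    by have [_] := dP t (lt_trans (a0 n) t0).
apply: cvg_EFin; first by near=> n.
rewrite -[X in _ --> X]subr0; apply: cvgB; first exact: cvg_cst.
have := @continuous_powR_max _ x x0 0%R.
rewrite /continuous_at maxxx powR0 ?gt_eqF// => c0.
have ca : a n @[n --> \oo] --> (0 : R)%R.
  rewrite -(mulr0 (s / 2)%R); apply: cvgM; first exact: cvg_cst.
  exact: cvg_harmonic.
exact: (cvg_comp _ _ ca c0).
Unshelve. all: by end_near. Qed.

Lemma integral_gamma_rec (x : R) : (0 < x)%R ->
  \int[mu]_(t in `]0%R, +oo[) (t `^ x * expR (- t))%:E =
  x%:E * \int[mu]_(t in `]0%R, +oo[) (t `^ (x - 1) * expR (- t))%:E.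
Proof.
move=> x0; rewrite -ge0_integralZl//; last 3 first.
- apply: measurable_funTS; apply/measurable_EFinP; apply: measurable_funM => //.
  by apply: measurableT_comp => //; exact: measurableT_comp.
- by move=> t _; rewrite lee_fin mulr_ge0 ?powR_ge0 ?expR_ge0.
- by rewrite lee_fin ltW.
under [RHS]eq_integral do rewrite -EFinM mulrA.
rewrite (@layer_cake_expR _ (fun t => x * t `^ (x - 1))%R id)//; last 3 first.
- by apply: measurable_funM.
- by move=> t _; rewrite mulr_ge0 ?powR_ge0// ltW.
- by move=> t /=; rewrite in_itv/= andbT => /ltW.
apply: eq_integral => s /[!inE]/=; rewrite in_itv/= andbT => s0.
rewrite EFinM; congr (_ * _); rewrite -integral_powR//.
congr (integral _ _ _); apply/seteqP; split=> t/=; rewrite !in_itv/= ?andbT.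
  by move=> /andP[].
by move=> [-> ->].
Qed.

(** The layers [{t > 0 | t^r < s}] are intervals of length [s^(1/r)]. *)
Lemma integral_expR_powR (r : R) : (0 < r)%R ->
  \int[mu]_(t in `]0%R, +oo[) (expR (- (t `^ r)))%:E =
  \int[mu]_(t in `]0%R, +oo[) (t `^ r^-1 * expR (- t))%:E.
Proof.
move=> r0; under eq_integral do rewrite -[X in X%:E]mul1r.
rewrite (@layer_cake_expR _ (cst 1%R) (fun t => t `^ r)%R)//; last first.
  by move=> t _; exact: powR_ge0.
apply: eq_integral => s /[!inE]/=; rewrite in_itv/= andbT => s0.
rewrite EFinM; congr (_ * _).
rewrite (_ : _ `&` _ = `]0%R, (s `^ r^-1)%R[%classic); last first.
  apply/seteqP; split=> t/=; rewrite !in_itv/= ?andbT.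
    move=> [t0 ts]; rewrite t0/=.
    have := @gt0_ltr_powR _ r^-1%R _ (t `^ r)%R s.
    rewrite invr_gt0 r0 !nnegrE powR_ge0 (ltW s0) => /(_ isT isT isT ts).
    by rewrite -powRrM divff ?gt_eqF// powRr1// ltW.
  move=> /andP[t0 ts]; split=> //.
  have := @gt0_ltr_powR _ r r0 t (s `^ r^-1)%R.
  rewrite !nnegrE powR_ge0 (ltW t0) => /(_ isT isT ts).
  by rewrite -powRrM mulVf ?gt_eqF// powRr1// ltW.
rewrite integral_cst//= mul1e lebesgue_measure_itv/= lte_fin powR_gt0//.
by rewrite oppr0 adde0.
Qed.

(** [t^x <= 1 + t <= 2 exp (t/2)], and [exp (- t/2)] has integral 2. *)
Lemma integral_gamma_le (x : R) : (0 <= x <= 1)%R ->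
  \int[mu]_(t in `]0%R, +oo[) (t `^ x * expR (- t))%:E <= 4%:E.
Proof.
move=> /andP[x0 x1].
have h0 : (0 < 2^-1 :> R)%R by rewrite invr_gt0.
have := integral_expR_tail 0%R h0; rewrite mulr0 oppr0 expR0 => H.
rewrite -[leRHS]mule1 -H -ge0_integralZl//; last first.
  apply: measurable_funTS; apply/measurable_EFinP; apply: measurable_funM => //.
  by apply: measurableT_comp => //; apply: measurableT_comp => //; exact: measurable_funM.
apply: ge0_le_integral => //.
- by move=> t _; rewrite lee_fin mulr_ge0 ?powR_ge0 ?expR_ge0.
- apply: measurable_funTS; apply/measurable_EFinP; apply: measurable_funM => //.
  by apply: measurableT_comp => //; exact: measurableT_comp.
- apply: measurable_funeM; apply: measurable_funTS; apply/measurable_EFinP.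
  apply: measurable_funM => //.
  by apply: measurableT_comp => //; apply: measurableT_comp => //; exact: measurable_funM.
move=> t /=; rewrite in_itv/= andbT => t0; rewrite lee_fin mulrA.
have e1 := expR_ge1Dx (2^-1 * t).
have tx : (t `^ x <= 1 + t)%R.
  have [t1|t1] := leP 1%R t.
    by apply: (le_trans (ler_powR t1 x1)); rewrite powRr1 ?ltW//; lra.
  have : (t `^ x <= t `^ 0)%R by apply: ger_powR => //; rewrite t0 ltW.
  by rewrite powRr0; lra.
rewrite (_ : - t = - (2^-1 * t) + - (2^-1 * t))%R; last by lra.
rewrite expRD mulrA ler_pM2r ?expR_gt0// expRN ler_pdivrMr ?expR_gt0//; lra.
Qed.

End gamma.

(** * A Hardy inequality *)

Section calculus.
Context {R : realType}.
Notation mu := (@lebesgue_measure R).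

Lemma is_derive_continuous (f df : R -> R) :
  (forall x : R, is_derive x 1 f (df x)) -> continuous f.
Proof.
move=> dfE x; apply/differentiable_continuous/derivable1_diffP.
by have [] := dfE x.
Qed.

Lemma measurable_fun_EFin_continuous (D : set R) (f : R -> R) : continuous f ->
  measurable_fun D (fun x : measurableTypeR R => (f x)%:E).
Proof.
move=> cf; apply: measurable_funTS; apply/measurable_EFinP.
exact: continuous_measurable_fun.
Qed.

Lemma integrable_continuous_cc (f : R -> R) (a b : R) : continuous f ->
  mu.-integrable `[a, b] (fun x => (f x)%:E).
Proof.
move=> cf; apply: continuous_compact_integrable; first exact: segment_compact.
exact: continuous_subspaceT.
Qed.

Lemma FTC_le (F dF u v : R -> R) (a b : R) : a < b ->
  (forall x : R, is_derive x 1 F (dF x)) -> continuous dF ->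
  continuous u -> continuous v ->
  (forall x, a <= x <= b -> dF x + u x <= v x) ->
  ((F b - F a)%:E + \int[mu]_(x in `[a, b]) (u x)%:E <=
   \int[mu]_(x in `[a, b]) (v x)%:E)%E.
Proof.
move=> ab dFE cdF cu cv uv; have cF := is_derive_continuous dFE.
rewrite EFinB -(@continuous_FTC2 _ dF F)//; last 3 first.
- exact: continuous_subspaceT.
- split; first by move=> x _; have [] := dFE x.
    by apply: cvg_at_right_filter; exact: cF.
  by apply: cvg_at_left_filter; exact: cF.
- by move=> x _; rewrite derive1E; have [_] := dFE x.
rewrite -integralD//; try exact: integrable_continuous_cc.
apply: le_integral => //.
- by apply: integrableD => //; exact: integrable_continuous_cc.
- exact: integrable_continuous_cc.
- by move=> x /[!inE]/=; rewrite in_itv/= -EFinD lee_fin; exact: uv.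
Qed.

(** Comparison on bounded segments issued from 0 is enough, so no behaviour at infinity has to be
    controlled. *)
Lemma integral_le_segments (u v : R -> R) : continuous u -> continuous v ->
  (forall x, 0 <= u x) -> (forall x, 0 <= v x) ->
  (forall b : R, 0 < b -> (\int[mu]_(x in `[0%R, b]) (u x)%:E <=
    \int[mu]_(x in `[0%R, b]) (v x)%:E)%E) ->
  (forall a : R, a < 0 -> (\int[mu]_(x in `[a, 0%R]) (u x)%:E <=
    \int[mu]_(x in `[a, 0%R]) (v x)%:E)%E) ->
  (\int[mu]_x (u x)%:E <= \int[mu]_x (v x)%:E)%E.
Proof.
move=> cu cv u0 v0 Hp Hn.
have split_itv (w : R -> R) (n : nat) : continuous w -> (forall x, 0 <= w x) ->
    (\int[mu]_(x in `[(- n.+1%:R)%R, n.+1%:R]) (w x)%:E =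
     \int[mu]_(x in `[(- n.+1%:R)%R, 0%R]) (w x)%:E +
     \int[mu]_(x in `[0%R, n.+1%:R]) (w x)%:E)%E.
  move=> cw w0; rewrite -[X in _ = (X + _)%E]integral_itv_bndo_bndc; last exact: measurable_fun_EFin_continuous.
  rewrite -ge0_integral_setU//.
  - rewrite -itv_bndbnd_setU// bnd_simp// ?lerNl ?oppr0//.
  - exact: measurable_fun_EFin_continuous.
  - by move=> x _; rewrite lee_fin.
  - apply/disj_setPS => x [/=]; rewrite !in_itv/= => /andP[_ x0] /andP[x0' _].
    by move: (lt_le_trans x0 x0'); rewrite ltxx.
pose I n : set R := `[(- n.+1%:R)%R, n.+1%:R]%classic.
have UI : \bigcup_n I n = setT.
  apply/seteqP; split=> // x _; exists (Num.truncn `|x|) => //.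
  by rewrite /I/= in_itv/= -ler_norml ltW// truncnS_gt.
have ndI : nondecreasing_seq I.
  apply/nondecreasing_seqP => n; rewrite subsetEset /I => t /=.
  rewrite !in_itv/= -!ler_norml => /le_trans; apply; by rewrite ler_nat.
have := @ge0_nondecreasing_set_cvg_integral _ (measurableTypeR R) _ I
  (fun x => (u x)%:E) mu ndI (fun n => measurable_itv _)
  (fun n => measurable_fun_EFin_continuous cu) (fun n x _ => u0 x).
rewrite UI => cvu; rewrite -(cvg_lim _ cvu)//; apply: lime_le.
  by apply/cvg_ex; eexists; exact: cvu.
apply: nearW => n; rewrite split_itv//.
apply: (@le_trans _ _ (\int[mu]_(x in I n) (v x)%:E)%E).
  by rewrite split_itv// leeD ?Hp ?Hn ?oppr_lt0.
apply: ge0_subset_integral => //; first exact: measurable_itv.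
  exact: measurable_fun_EFin_continuous.
by move=> x _; rewrite lee_fin.
Qed.

End calculus.

Section hardy.
Context {R : realType}.
Notation mu := (@lebesgue_measure R).
Implicit Types (q r x sg : R).

(* the Japanese bracket [<x>^(2 q)] *)
Definition japan q x : R := (1 + x ^+ 2) `^ q.

Lemma japan_base_gt0 x : 0 < 1 + x ^+ 2.
Proof. by rewrite ltr_wpDr// sqr_ge0. Qed.

Lemma japan_gt0 q x : 0 < japan q x.
Proof. exact/powR_gt0/japan_base_gt0. Qed.

Lemma japan_ge1 q x : 0 <= q -> 1 <= japan q x.
Proof.
move=> q0; rewrite -(powRr0 (1 + x ^+ 2)) ler_powR//.
by rewrite lerDl sqr_ge0.
Qed.

Lemma japan_le q q' x : q <= q' -> japan q x <= japan q' x.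
Proof. by move=> qq; rewrite ler_powR// lerDl sqr_ge0. Qed.

Lemma japanD q q' x : japan (q + q') x = japan q x * japan q' x.
Proof. by rewrite /japan powRD// (gt_eqF (japan_base_gt0 x)) implybT. Qed.

Lemma japan1 x : japan 1 x = 1 + x ^+ 2.
Proof. by rewrite /japan powRr1// ltW// japan_base_gt0. Qed.

Lemma is_derive_japan q x :
  is_derive x 1 (japan q) (q * japan (q - 1) x * (2 * x)).
Proof.
have d1 : is_derive x 1 (fun y : R => 1 + y ^+ 2) (2 * x).
  by apply: is_derive_eq; rewrite /GRing.scale/=; ring.
exact: (@is_derive1_comp _ _ (fun y : R => 1 + y ^+ 2) _ _ _
  (is_derive1_powR q (japan_base_gt0 x)) d1).
Qed.

Lemma continuous_japan q : continuous (japan q).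
Proof. exact: is_derive_continuous (is_derive_japan q). Qed.

Lemma continuous_expR_comp (f : R -> R) : continuous f ->
  continuous (fun x => expR (f x)).
Proof.
move=> cf x; apply: (@continuous_comp R^o R^o R^o f expR); first exact: cf.
exact: continuous_expR.
Qed.

Lemma continuous_sqr_comp (f : R -> R) : continuous f ->
  continuous (fun x => f x ^+ 2).
Proof.
move=> cf x; apply: (@continuous_comp R^o R^o R^o f (fun y => y ^+ 2)); first exact: cf.
exact: exprn_continuous.
Qed.

(* The Hardy inequality on the half line [0 <= sg * x] comes from integrating
   [(h^2 G)'], where [sg * h^2 G >= 0].  The factor [1 + exp (- sg x)] keeps
   [G' < 0] near [0], where the derivative of [(1 + x^2)^(r/2)] vanishes. *)
Definition hardyG r sg x : R :=
  sg * (japan ((r - 1) / 2) x * (1 + expR (- (sg * x))) * expR (- japan (r / 2) x)).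

Definition dhardyG r sg x : R :=
  sg * (((r - 1) / 2 * japan ((r - 1) / 2 - 1) x * (2 * x) * (1 + expR (- (sg * x)))
         - sg * (japan ((r - 1) / 2) x * expR (- (sg * x)))
         - japan ((r - 1) / 2) x * (1 + expR (- (sg * x)))
           * (r / 2 * japan (r / 2 - 1) x * (2 * x))) * expR (- japan (r / 2) x)).

Lemma is_derive_hardyG r sg x :
  is_derive x 1 (hardyG r sg) (dhardyG r sg x).
Proof.
have d1 := is_derive_japan ((r - 1) / 2) x.
have d2 := is_derive_japan (r / 2) x.
have d3 : is_derive x 1 (fun y : R => expR (- japan (r / 2) y))
    (expR (- japan (r / 2) x) * (- (r / 2 * japan (r / 2 - 1) x * (2 * x)))).
  exact: (@is_derive1_comp _ expR (fun y => - japan (r / 2) y)).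
have d4 : is_derive x 1 (fun y : R => expR (- (sg * y)))
    (expR (- (sg * x)) * (- sg)).
  apply: (@is_derive1_comp _ expR (fun y => - (sg * y))).
  by apply: is_derive_eq; rewrite /GRing.scale/=; ring.
rewrite /hardyG; apply: is_derive_eq; rewrite /dhardyG /GRing.scale/=; ring.
Qed.

Lemma continuous_dhardyG r sg : continuous (dhardyG r sg).
Proof.
have cj q := @continuous_japan q.
have cE : continuous (fun x : R => expR (- (sg * x))).
  apply: continuous_expR_comp => x; apply: cvgN.
  by apply: cvgM; [exact: cvg_cst|exact: cvg_id].
have cW : continuous (fun x : R => expR (- japan (r / 2) x)).
  by apply: continuous_expR_comp => x; apply: cvgN; exact: cj.
have c2 : continuous (fun x : R => 2 * x).
  by move=> x; apply: cvgM; [exact: cvg_cst|exact: cvg_id].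
have c1E : continuous (fun x : R => 1 + expR (- (sg * x))).
  by move=> x; apply: cvgD; [exact: cvg_cst|exact: cE].
move=> x; rewrite /dhardyG; apply: cvgM; first exact: cvg_cst.
apply: cvgM; last exact: cW.
apply: cvgB; [apply: cvgB|].
- apply: cvgM; last exact: c1E.
  by apply: cvgM; [apply: cvgM; [exact: cvg_cst|exact: cj]|exact: c2].
- by apply: cvgM; [exact: cvg_cst|apply: cvgM; [exact: cj|exact: cE]].
- apply: cvgM; first by apply: cvgM; [exact: cj|exact: c1E].
  by apply: cvgM; [apply: cvgM; [exact: cvg_cst|exact: cj]|exact: c2].
Qed.

(** Put [y = |x|]. After factoring, [- G'] is [rho * exp (- W)] times
    [E + (1 + E) * k * (r W - (r - 1))], where [W = rho * q >= 1] gives [r W - (r - 1) >= W]. It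
    remains to compare [E + (y / q) * rho] with [rho / 4]. *)
Lemma dhardyG_le r sg x : 1 <= r <= 2 -> sg ^+ 2 = 1 -> 0 <= sg * x ->
  dhardyG r sg x <= - (1 / 4 * japan (r - 1) x * expR (- japan (r / 2) x)).
Proof.
move=> /andP[r1 r2] sg2 sgx.
set y := sg * x.
have y2 : y ^+ 2 = x ^+ 2 by rewrite /y exprMn sg2 mul1r.
have ge1x := japan_base_gt0 x.
set s := 1 + x ^+ 2 in ge1x.
set rho := japan ((r - 1) / 2) x.
set q := japan 2^-1 x.
have q2 : q * q = s.
  rewrite /q -japanD (_ : 2^-1 + 2^-1 = 1 :> R) ?japan1//; lra.
have rho0 : 0 < rho by exact: japan_gt0.
have q0 : 0 < q by exact: japan_gt0.
have rho1 : 1 <= rho by apply: japan_ge1; lra.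
have rhoq : rho <= q by apply: japan_le; lra.
have Vm p : japan (p - 1) x = japan p x / s.
  have -> : japan p x = japan (p - 1) x * s.
    by rewrite -[s]japan1 -japanD subrK.
  by rewrite mulfK// gt_eqF.
have WE : japan (r / 2) x = rho * q.
  by rewrite /rho /q -japanD; congr (japan _ x); lra.
have rho2 : japan (r - 1) x = rho * rho.
  by rewrite /rho -japanD; congr (japan _ x); lra.
rewrite /dhardyG rho2 !Vm WE -/rho -/y [leLHS]mulrA [leRHS](esym (mulNr _ _)).
rewrite ler_pM2r ?expR_gt0//.
set E := expR (- y).
have E0 : 0 < E by exact: expR_gt0.
have E1 : 1 - y <= E by have := expR_ge1Dx (- y).
have W1 : 1 <= rho * q by nra.
set k := y / s.
have k0 : 0 <= k by rewrite divr_ge0// ltW.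
have -> : sg * ((r - 1) / 2 * (rho / s) * (2 * x) * (1 + E) - sg * (rho * E)
    - rho * (1 + E) * (r / 2 * (rho * q / s) * (2 * x))) =
  - (rho * (sg ^+ 2 * E + (1 + E) * k * (r * (rho * q) - (r - 1)))).
  by rewrite /k /y; field; rewrite gt_eqF.
rewrite sg2 mul1r lerN2 (_ : 1 / 4 * (rho * rho) = rho * (rho * (1 / 4))); last by ring.
rewrite ler_pM2l//.
have kW : k * (rho * q) <= (1 + E) * k * (r * (rho * q) - (r - 1)).
  have h1 : k * (rho * q) <= k * (r * (rho * q) - (r - 1)).
    by apply: ler_wpM2l => //; nra.
  have h2 : 0 <= E * (k * (r * (rho * q) - (r - 1))).
    by rewrite mulr_ge0 ?(ltW E0)// mulr_ge0//; nra.
  lra.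
have kq : k * q = y / q by rewrite /k -q2; field; rewrite gt_eqF.
have kW2 : k * (rho * q) = y / q * rho by rewrite -kq; ring.
suff : rho * (1 / 4) <= E + y / q * rho by lra.
(* Near 0 the term [E >= 1 - y >= 1/2] suffices, as [rho <= 2]; away from 0 the ratio [y / q] is at
   least 1/4. *)
have [yh|yh] := leP y 2^-1.
  have : rho <= 2.
    apply: (le_trans rhoq); rewrite -ler_sqr ?nnegrE ?(ltW q0)// expr2 q2 /s -y2.
    by rewrite /y in yh *; nra.
  have : 0 <= y / q * rho by rewrite mulr_ge0 ?divr_ge0 ?(ltW q0) ?(ltW rho0).
  lra.
have : 1 / 4 <= y / q.
  rewrite ler_pdivlMr// -ler_sqr ?nnegrE; [|lra|lra].
  by rewrite exprMn (expr2 q) q2 /s -y2; nra.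
by move=> h; have := ler_wpM2l (ltW rho0) h; lra.
Qed.

Lemma hardyG_le r sg x : sg ^+ 2 = 1 -> 0 <= sg * x ->
  `|hardyG r sg x| <= 2 * japan ((r - 1) / 2) x * expR (- japan (r / 2) x).
Proof.
move=> sg2 sgx.
have -> : `|hardyG r sg x| =
  japan ((r - 1) / 2) x * (1 + expR (- (sg * x))) * expR (- japan (r / 2) x).
  rewrite /hardyG normrM.
  have -> : `|sg| = 1 by apply/eqP; rewrite -sqr_norm_eq1 ?sg2.
  by rewrite mul1r ger0_norm// !mulr_ge0 ?expR_ge0 ?ltW ?japan_gt0// addr_gt0 ?expR_gt0.
rewrite ler_pM2r ?expR_gt0// [leRHS]mulrC ler_pM2l ?japan_gt0//.
have : expR (- (sg * x)) <= 1 by rewrite expR_le1 oppr_le0.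
lra.
Qed.

(** Eight times the bound on [G'] gives [- 2 h^2 rho^2 E]. One half pays for the weighted term on
    the left; the other absorbs the cross term [32 |h h'| rho E] through the square
    [(|h| rho - 16 |h'|)^2], whence 256. *)
Lemma hardy_pointwise r sg x (h h' : R) :
  1 <= r <= 2 -> sg ^+ 2 = 1 -> 0 <= sg * x ->
  8 * (2 * h * h' * hardyG r sg x + h ^+ 2 * dhardyG r sg x)
    + h ^+ 2 * japan (r - 1) x * expR (- japan (r / 2) x)
  <= 256 * (h' ^+ 2 * expR (- japan (r / 2) x)).
Proof.
move=> r12 sg2 sgx.
have G1 := hardyG_le r sg2 sgx; have G2 := dhardyG_le r12 sg2 sgx.
set E := expR (- japan (r / 2) x) in G1 G2 *.
have E0 : 0 < E by exact: expR_gt0.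
have rho2 : japan (r - 1) x = japan ((r - 1) / 2) x ^+ 2.
  by rewrite expr2 -japanD; congr (japan _ x); lra.
have rho0 := japan_gt0 ((r - 1) / 2) x.
rewrite rho2 in G2 *; set rho := japan _ x in G1 G2 rho0 *.
have H1 : h ^+ 2 * dhardyG r sg x <= h ^+ 2 * - (1 / 4 * rho ^+ 2 * E).
  by rewrite ler_wpM2l// sqr_ge0.
have H2 : h * h' * hardyG r sg x <= `|h| * `|h'| * (2 * rho * E).
  apply: le_trans (ler_norm _) _.
  by rewrite normrM (normrM h) ler_wpM2l ?mulr_ge0.
have H3 : 0 <= E * (`|h| * rho - 16 * `|h'|) ^+ 2.
  by rewrite mulr_ge0 ?sqr_ge0// ltW.
have -> : h ^+ 2 = `|h| ^+ 2 by rewrite real_normK ?num_real.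
have -> : h' ^+ 2 = `|h'| ^+ 2 by rewrite real_normK ?num_real.
rewrite -(real_normK (num_real h)) in H1.
have -> : 8 * (2 * h * h' * hardyG r sg x + `|h| ^+ 2 * dhardyG r sg x) =
  16 * (h * h' * hardyG r sg x) + 8 * (`|h| ^+ 2 * dhardyG r sg x) by ring.
have -> : 256 * (`|h'| ^+ 2 * E) = E * (`|h| * rho - 16 * `|h'|) ^+ 2 +
   (16 * (`|h| * `|h'| * (2 * rho * E)) + 8 * (`|h| ^+ 2 * - (1 / 4 * rho ^+ 2 * E))
   + `|h| ^+ 2 * rho ^+ 2 * E) by field.
lra.
Qed.

(** With [h = f - f 0], the boundary term of [8 h^2 G] is 0 at the origin and has the favourable
    sign at the other end. Dropping it spares any growth condition on [f]. *)
Lemma hardy_japan r (f df : R -> R) : 1 <= r <= 2 ->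
  (forall x : R, is_derive x 1 f (df x)) -> continuous df ->
  (\int[mu]_x ((f x - f 0%R) ^+ 2 * japan (r - 1) x
     * expR (- japan (r / 2) x))%:E <=
   256%:E * \int[mu]_x (df x ^+ 2 * expR (- japan (r / 2) x))%:E)%E.
Proof.
move=> r12 dfE cdf.
have cf := is_derive_continuous dfE.
have cW : continuous (fun x : R => expR (- japan (r / 2) x)).
  by apply: continuous_expR_comp => x; apply: cvgN; exact: continuous_japan.
pose h x := f x - f 0.
have dh (x : R) : is_derive x 1 h (df x).
  by apply: is_derive_eq; rewrite subr0.
have ch := is_derive_continuous dh.
pose u x := h x ^+ 2 * japan (r - 1) x * expR (- japan (r / 2) x).
pose w x := df x ^+ 2 * expR (- japan (r / 2) x).
have cu : continuous u.
  move=> x; apply: cvgM; last exact: cW.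
  by apply: cvgM; [exact: continuous_sqr_comp|exact: continuous_japan].
have cw : continuous w.
  move=> x; apply: cvgM; last exact: cW.
  exact: continuous_sqr_comp.
have cv : continuous (fun x => 256 * w x).
  by move=> x; apply: cvgM; [exact: cvg_cst|exact: cw].
rewrite -ge0_integralZl//; last 2 first.
- exact: measurable_fun_EFin_continuous.
- by move=> x _; rewrite lee_fin mulr_ge0 ?sqr_ge0 ?expR_ge0.
under [leRHS]eq_integral do rewrite -EFinM.
pose F sg x := 8 * (h x ^+ 2 * hardyG r sg x).
pose dF sg x := 8 * (2 * h x * df x * hardyG r sg x + h x ^+ 2 * dhardyG r sg x).
have dFE sg (x : R) : is_derive x 1 (F sg) (dF sg x).
  have d1 := dh x; have d2 := is_derive_hardyG r sg x.
  by apply: is_derive_eq; rewrite /dF /GRing.scale/=; ring.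
have cG sg := is_derive_continuous (@is_derive_hardyG r sg).
have cdF sg : continuous (dF sg).
  move=> x; apply: cvgM; first exact: cvg_cst.
  apply: cvgD.
    apply: cvgM; last exact: cG.
    by apply: cvgM; [apply: cvgM; [exact: cvg_cst|exact: ch]|exact: cdf].
  by apply: cvgM; [exact: continuous_sqr_comp|exact: continuous_dhardyG].
have h0 : h 0 = 0 by rewrite /h subrr.
have sgG sg x : sg ^+ 2 = 1 -> 0 <= sg * F sg x.
  move=> sg2; rewrite /F /hardyG.
  have -> : sg * (8 * (h x ^+ 2 * (sg * (japan ((r - 1) / 2) x *
    (1 + expR (- (sg * x))) * expR (- japan (r / 2) x))))) =
    8 * (h x ^+ 2 * (sg ^+ 2 * (japan ((r - 1) / 2) x *
    (1 + expR (- (sg * x))) * expR (- japan (r / 2) x)))) by ring.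
  rewrite sg2 mul1r; apply: mulr_ge0 => //; apply: (mulr_ge0 (sqr_ge0 _)).
  apply: mulr_ge0 (expR_ge0 _); apply: (mulr_ge0 (ltW (japan_gt0 _ _))).
  by rewrite addr_ge0 ?expR_ge0.
apply: integral_le_segments => //.
- move=> x; apply: mulr_ge0 (expR_ge0 _).
  exact: mulr_ge0 (sqr_ge0 _) (ltW (japan_gt0 _ _)).
- by move=> x; apply: mulr_ge0 => //; exact: mulr_ge0 (sqr_ge0 _) (expR_ge0 _).
- move=> b b0; apply: le_trans (FTC_le b0 (dFE 1) (cdF 1) cu cv _); last first.
    move=> x /andP[x0 _]; apply: hardy_pointwise => //; first by rewrite expr1n.
    by rewrite mul1r.
  rewrite leeDr// lee_fin subr_ge0 {1}/F h0 expr0n mul0r mulr0.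
  by have := sgG 1 b (expr1n _ _); rewrite mul1r.
- move=> b b0; apply: le_trans (FTC_le b0 (dFE (-1)) (cdF (-1)) cu cv _); last first.
    move=> x /andP[_ x0]; apply: hardy_pointwise => //; first by rewrite sqrrN expr1n.
    by rewrite mulN1r oppr_ge0.
  rewrite leeDr// lee_fin {1}/F h0 expr0n mul0r mulr0 sub0r.
  by have := sgG (-1) b; rewrite sqrrN expr1n mulN1r; exact.
Qed.

End hardy.

(** * The measure mu_r on the line *)

Section density_prob.
Local Open Scope ereal_scope.
Context d (T : measurableType d) (R : realType).
Context (mu : {measure set T -> \bar R}) (g : T -> R).
Context (mg : measurable_fun setT g) (g0 : forall x, (0 <= g x)%R).
Context (g1 : \int[mu]_x (g x)%:E = 1).

(** The proofs are arguments so that the measure and probability instances can be inferred from the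
    term itself. *)
Definition density_prob of measurable_fun setT g & (forall x, (0 <= g x)%R)
    & \int[mu]_x (g x)%:E = 1 : set T -> \bar R :=
  fun A => \int[mu]_(x in A) (g x)%:E.

Notation P := (density_prob mg g0 g1).

Let mEg (D : set T) : measurable_fun D (EFin \o g).
Proof. by apply: measurable_funTS; exact/measurable_EFinP. Qed.

Let P0 : P set0 = 0. Proof. exact: integral_set0. Qed.

Let P_ge0 A : 0 <= P A.
Proof. by apply: integral_ge0 => x _; rewrite lee_fin. Qed.

Let P_sigma_additive : semi_sigma_additive P.
Proof.
move=> /= A mA tA mUA; rewrite /density_prob ge0_integral_bigcup//=; last first.
  by move=> x _; rewrite lee_fin.
by apply: is_cvg_ereal_nneg_natsum_cond => n _ _; exact: P_ge0.
Qed.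

HB.instance Definition _ := isMeasure.Build _ _ _ P P0 P_ge0 P_sigma_additive.

Let P_setT : P setT = 1. Proof. exact: g1. Qed.

HB.instance Definition _ := @Measure_isProbability.Build _ _ R P P_setT.

Import HBNNSimple.

(** On a simple function both sides are the same finite sum over its range; monotone convergence
    does the rest. *)
Lemma integral_density_prob (f : T -> \bar R) : measurable_fun setT f ->
  (forall x, 0 <= f x) -> \int[P]_x f x = \int[mu]_x (f x * (g x)%:E).
Proof.
move=> mf f0; pose h := nnsfun_approx measurableT mf.
have hf x : EFin \o h ^~ x @ \oo --> f x by exact: cvg_nnsfun_approx.
have ndh x : {homo (fun n => h n x) : m n / (m <= n)%N >-> (m <= n)%R}.
  by move=> m n mn; exact/lefP/nd_nnsfun_approx.
have mh n : measurable_fun setT (fun x => (h n x)%:E).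
  exact/measurable_EFinP.
have mhg n : measurable_fun setT (fun x => (h n x)%:E * (g x)%:E).
  exact: emeasurable_funM.
have H1 : \int[P]_x (h n x)%:E @[n --> \oo] --> \int[P]_x f x.
  have -> : \int[P]_x f x = \int[P]_x limn (fun n => (h n x)%:E).
    by apply: eq_integral => x _; apply/esym/cvg_lim => //; exact: hf.
  apply: cvg_monotone_convergence => //.
  - by move=> n x _; rewrite lee_fin.
  - by move=> x _ m n mn; rewrite lee_fin; exact: ndh.
have H2 : \int[mu]_x ((h n x)%:E * (g x)%:E) @[n --> \oo] -->
    \int[mu]_x (f x * (g x)%:E).
  have -> : \int[mu]_x (f x * (g x)%:E) =
      \int[mu]_x limn (fun n => (h n x)%:E * (g x)%:E).
    apply: eq_integral => x _; apply/esym/cvg_lim => //.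
    by apply: cvgeZr => //; exact: hf.
  apply: cvg_monotone_convergence => //.
  - by move=> n x _; rewrite mule_ge0// lee_fin.
  - by move=> x _ m n mn; rewrite lee_wpmul2r ?lee_fin//; exact: ndh.
rewrite -(cvg_lim _ H1)// -(cvg_lim _ H2)//; congr (limn _); apply/funext => n.
rewrite integralT_nnsfun sintegralE.
have mI r : measurable_fun setT (fun x => (r * \1_(h n @^-1` [set r]) x)%:E).
  by apply/measurable_EFinP; exact: measurable_funM.
transitivity (\int[mu]_x (\sum_(r \in range (h n))
    ((r * \1_(h n @^-1` [set r]) x)%:E * (g x)%:E))); last first.
  apply: eq_integral => x _; rewrite -ge0_mule_fsuml.
    by rewrite fsumEFin// -fimfunE.
  by move=> r; exact: nnfun_muleindic_ge0.
rewrite ge0_integral_fsum//; last 2 first.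
- by move=> r; exact: emeasurable_funM.
- by move=> r x _; rewrite mule_ge0 ?lee_fin//; exact: nnfun_muleindic_ge0.
apply: eq_fsbigr => r /[!inE] -[x _ <-].
under [RHS]eq_integral do rewrite EFinM -muleA.
rewrite ge0_integralZl//; last 3 first.
- by apply: emeasurable_funM => //; exact/measurable_EFinP.
- by move=> y _; rewrite mule_ge0// lee_fin.
- by rewrite lee_fin.
congr (_ * _); rewrite [LHS]integral_mkcond.
apply: eq_integral => y _; rewrite patchE indicE.
by case: ifPn => _; rewrite ?mul1e ?mul0e.
Qed.

End density_prob.

(** * The normalising constant and its uniform bounds *)

Section normalisation.
Context {R : realType}.
Notation mu := (@lebesgue_measure R).
Implicit Types x r : R.

Lemma Gamma1DE x : 0 <= x <= 1 ->
  (\int[mu]_(t in `]0%R, +oo[) (t `^ x * expR (- t))%:E = (Gamma (1 + x))%:E)%E.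
Proof.
move=> x01; rewrite /Gamma /Rintegral.
under [X in fine X]eq_integral do rewrite addrAC subrr add0r.
rewrite fineK// ge0_fin_numE; first exact: le_lt_trans (integral_gamma_le x01) (ltry _).
by apply: integral_ge0 => t _; rewrite lee_fin mulr_ge0 ?powR_ge0 ?expR_ge0.
Qed.

Lemma Gamma1D_le x : 0 <= x <= 1 -> Gamma (1 + x) <= 4.
Proof. by move=> x01; rewrite -lee_fin -Gamma1DE//; exact: integral_gamma_le. Qed.

(** In the form [exp (- t^(1/x))] the integrand is at least [exp (- 1)] on []0, 1[]. *)
Lemma Gamma1D_gt0 x : 0 < x <= 1 -> 0 < Gamma (1 + x).
Proof.
move=> /andP[x0 x1]; rewrite -lte_fin -Gamma1DE ?x1 ?ltW//.
rewrite -[x]invrK -integral_expR_powR ?invr_gt0//.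
apply: (@lt_le_trans _ _ (\int[mu]_(t in `]0%R, 1%R[) (expR (- 1%R))%:E)%E).
  rewrite integral_cst//= lebesgue_measure_itv/= lte_fin ltr01 oppr0 adde0.
  by rewrite mule1 lte_fin expR_gt0.
have mE : measurable_fun [set: R] (fun t => (expR (- (t `^ x^-1)))%:E).
  apply/measurable_EFinP; apply: measurableT_comp => //.
  by apply: measurableT_comp => //; exact: measurable_powR.
apply: (@le_trans _ _ (\int[mu]_(t in `]0%R, 1%R[) (expR (- (t `^ x^-1)))%:E)%E).
  apply: ge0_le_integral => //.
  - exact: measurable_funTS.
  - move=> t /=; rewrite in_itv/= => /andP[t0 t1].
    rewrite lee_fin ler_expR lerN2 -(powRr0 t); apply: ger_powR.
      by rewrite t0 ltW.
    by rewrite invr_ge0 ltW.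
apply: ge0_subset_integral => //; first exact: measurable_funTS.
by move=> t /=; rewrite !in_itv/= andbT => /andP[].
Qed.

Lemma Gamma1D x : 0 < x <= 1 -> Gamma (1 + x) = x * Gamma x.
Proof.
move=> /andP[x0 x1]; have x01 : 0 <= x <= 1 by rewrite x1 ltW.
have := Gamma1DE x01; rewrite integral_gamma_rec// => H.
rewrite /Gamma in H *; rewrite -[LHS]/(fine (_%:E)) -H.
set I := integral _ _ _ in H *.
(* Were the integral behind [Gamma x] infinite, so would be [x] times it, which is the finite
   [Gamma (1 + x)]. Hence [fine] returns no default value here. *)
have [IE|IE] := boolP (I \is a fin_num).
  by rewrite fineM.
suff : (x%:E * I = +oo)%E by rewrite H.
have : (0 <= I)%E by apply: integral_ge0 => t _; rewrite lee_fin mulr_ge0 ?powR_ge0 ?expR_ge0.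
by move: IE; case: (I) => // _ _; rewrite gt0_muley// lte_fin.
Qed.

Lemma c_rE r : 1 <= r -> c_r r = r / (2 * Gamma r^-1).
Proof.
move=> r1; have r0 : 0 < r by lra.
have x01 : 0 < r^-1 <= 1 by rewrite invr_gt0 r0 invf_le1.
have := Gamma1D_gt0 x01; rewrite /c_r (Gamma1D x01) pmulr_rgt0 ?invr_gt0// => G0.
by field; rewrite !gt_eqF.
Qed.

Lemma c_r_gt0 r : 1 <= r -> 0 < c_r r.
Proof.
move=> r1; have r0 : 0 < r by lra.
by rewrite invr_gt0 mulr_gt0// Gamma1D_gt0// invr_gt0 r0 invf_le1.
Qed.

Lemma invc_r_le r : 1 <= r -> (c_r r)^-1 <= 8.
Proof.
move=> r1; have r0 : 0 < r by lra.
have : Gamma (1 + r^-1) <= 4 by rewrite Gamma1D_le// invr_ge0 ltW//= invf_le1.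
by rewrite /c_r invrK; lra.
Qed.

Definition gdens r x : R := c_r r * expR (- (`|x| `^ r)).

Lemma gdens_ge0 r x : 1 <= r -> 0 <= gdens r x.
Proof. by move=> r1; rewrite mulr_ge0 ?expR_ge0// ltW// c_r_gt0. Qed.

Lemma continuous_gdens r : 1 <= r -> continuous (gdens r).
Proof.
move=> r1; have r0 : 0 < r by lra.
have cp : continuous (fun x : R => `|x| `^ r).
  have -> : (fun x : R => `|x| `^ r) = (fun x : R => Num.max 0 `|x| `^ r).
    by apply/funext => y; rewrite max_r.
  move=> x.
  apply: (@continuous_comp R^o R^o R^o (fun x => `|x|) (fun y => Num.max 0 y `^ r)).
    exact: norm_continuous.
  exact: continuous_powR_max.
move=> x; apply: cvgM; first exact: cvg_cst.
by apply: (@continuous_expR_comp _ (fun x => - (`|x| `^ r))) => y; apply: cvgN; exact: cp.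
Qed.

Lemma measurable_gdens r : 1 <= r ->
  measurable_fun [set: measurableTypeR R] (gdens r).
Proof.
move=> r1; apply: continuous_measurable_fun; exact: continuous_gdens.
Qed.

Lemma integral_gdens r : 1 <= r -> (\int[mu]_x (gdens r x)%:E = 1)%E.
Proof.
move=> r1; have r0 : 0 < r by lra.
have cr0 := c_r_gt0 r1.
rewrite ge0_symfun_integralT; last 3 first.
- by move=> x; exact: gdens_ge0.
- exact: continuous_gdens.
- by move=> x; rewrite /gdens/= normrN.
rewrite -set_itvcy -integral_itv_obnd_cbnd; last first.
  by apply: measurable_fun_EFin_continuous; exact: continuous_gdens.
have -> : (\int[mu]_(x in `]0%R, +oo[) (gdens r x)%:E =
   (c_r r)%:E * \int[mu]_(x in `]0%R, +oo[) (expR (- (x `^ r)))%:E)%E.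
  have E x : `]0, +oo[%classic x -> gdens r x = c_r r * expR (- (x `^ r)).
    by rewrite /= in_itv/= andbT => x0; rewrite /gdens gtr0_norm.
  under eq_integral => x /[!inE] /E -> do rewrite EFinM.
  rewrite ge0_integralZl; [by []|exact: measurable_itv| | |by rewrite lee_fin ltW].
  - apply: measurable_funTS; apply/measurable_EFinP; apply: measurableT_comp => //.
    by apply: measurableT_comp => //; exact: measurable_powR.
  - by move=> x _; rewrite lee_fin expR_ge0.
rewrite integral_expR_powR// Gamma1DE ?invr_ge0 ?(ltW r0) ?invf_le1//.
rewrite -!EFinM; congr EFin.
have G0 : 2 * Gamma (1 + r^-1) != 0.
  by rewrite -invr_eq0; exact: lt0r_neq0.
by rewrite mulrCA /c_r mulVf.
Qed.

End normalisation.

(** * Real-valued means under a probability *)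

Section mean.
Context d (T : measurableType d) (R : realType) (P : probability T R).
Implicit Types u v : T -> R.

Definition mean u : R := \int[P]_x u x.
Definition meanable u := P.-integrable setT (fun x => (u x)%:E).

Lemma mean_EFin u : meanable u -> (\int[P]_x (u x)%:E = (mean u)%:E)%E.
Proof. by move=> iu; rewrite /mean /Rintegral fineK//; exact: integrable_fin_num. Qed.

Lemma meanableD u v : meanable u -> meanable v -> meanable (fun x => u x + v x).
Proof.
move=> iu iv; have := integrableD measurableT iu iv.
by apply: eq_integrable.
Qed.

Lemma meanableZ k u : meanable u -> meanable (fun x => k * u x).
Proof.
move=> iu; have := integrableZl measurableT k iu.
by apply: eq_integrable.
Qed.

Lemma meanable_cst k : meanable (fun=> k).
Proof. exact: finite_measure_integrable_cst. Qed.

Lemma meanable_le u v : measurable_fun setT u -> (forall x, 0 <= u x <= v x) ->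
  meanable v -> meanable u.
Proof.
move=> mu uv; apply: le_integrable => //; first exact/measurable_EFinP.
move=> x _; have /andP[u0 le_uv] := uv x.
by rewrite /= lee_fin !ger0_norm// (le_trans u0).
Qed.

Lemma meanable_fin u : measurable_fun setT u -> (forall x, 0 <= u x) ->
  (\int[P]_x (u x)%:E < +oo)%E -> meanable u.
Proof.
move=> mu u0 uoo; apply/integrableP; split; first exact/measurable_EFinP.
by under eq_integral do rewrite gee0_abs ?lee_fin//.
Qed.

Lemma meanD u v : meanable u -> meanable v ->
  mean (fun x => u x + v x) = mean u + mean v.
Proof. by move=> iu iv; exact: RintegralD. Qed.

Lemma meanZ k u : meanable u -> mean (fun x => k * u x) = k * mean u.
Proof. by move=> iu; exact: RintegralZl. Qed.

Lemma mean_cst k : mean (fun=> k) = k.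
Proof.
rewrite /mean Rintegral_cst// -[RHS]mulr1.
congr (_ * _); rewrite -[RHS]/(fine 1%E); congr fine; exact: probability_setT.
Qed.

Lemma mean_le u v : meanable u -> meanable v -> (forall x, u x <= v x) ->
  mean u <= mean v.
Proof. by move=> iu iv uv; apply: le_Rintegral. Qed.

Lemma mean_ge0 u : (forall x, 0 <= u x) -> 0 <= mean u.
Proof. by move=> u0; apply: Rintegral_ge0. Qed.

End mean.

(** * Comparison of [|x|^r] with the smooth potential *)

Section one_dim.
Context {R : realType} (r : R) (r1 : 1 <= r) (r2 : r <= 2).
Notation mu := (@lebesgue_measure R).

Definition mu1 : probability (measurableTypeR R) R :=
  density_prob (measurable_gdens r1) (fun x => @gdens_ge0 R r x r1)
    (integral_gdens r1).

(** 256 comes from the Hardy inequality for the smooth density, [e] from the ratio of the two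
    densities. *)
Definition hardy_cst : R := 256 * expR 1.

Lemma powR_le_japan (x : R) : `|x| `^ r <= japan (r / 2) x.
Proof.
move: (r1) (r2) => r1' r2'.
have -> : `|x| `^ r = (`|x| ^+ 2) `^ (r / 2).
  by rewrite -powR_mulrn// -powRrM mulrCA divff// mulr1.
rewrite real_normK ?num_real// /japan.
have x2 := sqr_ge0 x.
by apply: ge0_ler_powR; rewrite ?nnegrE//; lra.
Qed.

(** This is [(1 + t)^k <= 1 + t^k] for [t = x^2] and [k = r/2 <= 1]. Bernoulli applies directly if
    [t <= 1], and after factoring out [t] otherwise. *)
Lemma japan_le_powR (x : R) : japan (r / 2) x <= 1 + `|x| `^ r.
Proof.
move: (r1) (r2) => r1' r2'.
have -> : `|x| `^ r = (x ^+ 2) `^ (r / 2).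
  by rewrite -(real_normK (num_real x)) -powR_mulrn// -powRrM mulrCA divff// mulr1.
rewrite /japan; set t := x ^+ 2; set k := r / 2.
have t0 : 0 <= t by exact: sqr_ge0.
have k01 : 0 <= k <= 1 by rewrite /k; lra.
have [t1|t1] := leP t 1.
  apply: (le_trans (powR_bernoulli_le (addr_ge0 ler01 t0) k01)).
  have [->|tn0] := eqVneq t 0.
    by rewrite addr0 subrr mulr0 addr0 lerDl powR_ge0.
  have : t <= t `^ k by apply: ger1_powR; [rewrite lt_neqAle eq_sym tn0 t0 t1|lra].
  by nra.
have tp : 0 < t by lra.
have -> : 1 + t = t * (1 + t^-1) by field; rewrite gt_eqF.
have tV0 : 0 <= 1 + t^-1 by rewrite addr_ge0// invr_ge0.
rewrite powRM//.
have := powR_bernoulli_le tV0 k01; rewrite addrAC subrr add0r => H.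
have : t `^ k * (1 + t^-1) `^ k <= t `^ k * (1 + k * t^-1).
  by rewrite ler_wpM2l// powR_ge0.
move/le_trans; apply.
have : t `^ k <= t by rewrite ler1_powR//; lra.
rewrite mulrDr mulr1 addrC lerD2r => H2.
rewrite mulrA -ler_pdivlMr ?invr_gt0// invrK mul1r.
by have := powR_ge0 t k; nra.
Qed.

Lemma gdens_le_japan (x : R) :
  gdens r x <= c_r r * expR 1 * expR (- japan (r / 2) x).
Proof.
rewrite /gdens -mulrA ler_pM2l ?c_r_gt0// -expRD ler_expR.
by have := japan_le_powR x; lra.
Qed.

Lemma japan_le_gdens (x : R) : c_r r * expR (- japan (r / 2) x) <= gdens r x.
Proof.
by rewrite /gdens ler_pM2l ?c_r_gt0// ler_expR lerN2 powR_le_japan.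
Qed.

Lemma continuous_japan_expR : continuous (fun x : R => expR (- japan (r / 2) x)).
Proof.
by apply: continuous_expR_comp => x; apply: cvgN; exact: continuous_japan.
Qed.

Lemma integral_japan_le (u : R -> R) : continuous u -> (forall x, 0 <= u x) ->
  ((c_r r)%:E * \int[mu]_x (u x * expR (- japan (r / 2) x))%:E
   <= \int[mu1]_x (u x)%:E)%E.
Proof.
move=> cu u0; have cr0 := c_r_gt0 r1.
rewrite integral_density_prob; [|exact: measurable_fun_EFin_continuous|by move=> x; rewrite lee_fin].
have cue : continuous (fun x => u x * expR (- japan (r / 2) x)).
  by move=> x; apply: cvgM; [exact: cu|exact: continuous_japan_expR].
have ue0 x : 0 <= u x * expR (- japan (r / 2) x) by rewrite mulr_ge0 ?expR_ge0.
rewrite -ge0_integralZl; [|exact: measurableT|exact: measurable_fun_EFin_continuous|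
  by move=> x _; rewrite lee_fin|by rewrite lee_fin ltW].
apply: ge0_le_integral => //.
- by move=> x _; rewrite mule_ge0 ?lee_fin// ltW.
- by apply: measurable_funeM; exact: measurable_fun_EFin_continuous.
- apply: emeasurable_funM; first exact: measurable_fun_EFin_continuous.
  by apply: measurable_fun_EFin_continuous; exact: continuous_gdens.
- move=> x _; rewrite -!EFinM lee_fin [leLHS]mulrCA.
  by rewrite ler_wpM2l ?japan_le_gdens.
Qed.

Lemma le_integral_japan (u : R -> R) : continuous u -> (forall x, 0 <= u x) ->
  (\int[mu1]_x (u x)%:E <=
   (c_r r * expR 1)%:E * \int[mu]_x (u x * expR (- japan (r / 2) x))%:E)%E.
Proof.
move=> cu u0; have cr0 := c_r_gt0 r1.
rewrite integral_density_prob; [|exact: measurable_fun_EFin_continuous|by move=> x; rewrite lee_fin].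
have cue : continuous (fun x => u x * expR (- japan (r / 2) x)).
  by move=> x; apply: cvgM; [exact: cu|exact: continuous_japan_expR].
have ue0 x : 0 <= u x * expR (- japan (r / 2) x) by rewrite mulr_ge0 ?expR_ge0.
have ce0 : 0 <= c_r r * expR 1 by rewrite mulr_ge0 ?expR_ge0// ltW.
rewrite -ge0_integralZl; [|exact: measurableT|exact: measurable_fun_EFin_continuous|
  by move=> x _; rewrite lee_fin|by rewrite lee_fin].
apply: ge0_le_integral => //.
- by move=> x _; rewrite mule_ge0 ?lee_fin// gdens_ge0.
- apply: emeasurable_funM; first exact: measurable_fun_EFin_continuous.
  by apply: measurable_fun_EFin_continuous; exact: continuous_gdens.
- by apply: measurable_funeM; exact: measurable_fun_EFin_continuous.
- move=> x _; rewrite -!EFinM lee_fin [leRHS]mulrCA.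
  by rewrite ler_wpM2l ?gdens_le_japan.
Qed.

Lemma hardy_mu1 (f df : R -> R) :
  (forall x : R, is_derive x 1 f (df x)) -> continuous df ->
  meanable mu1 (fun x => df x ^+ 2) ->
  meanable mu1 (fun x => (f x - f 0) ^+ 2 * japan (r - 1) x) /\
  mean mu1 (fun x => (f x - f 0) ^+ 2 * japan (r - 1) x) <=
    hardy_cst * mean mu1 (fun x => df x ^+ 2).
Proof.
move=> dfE cdf idf; have cr0 := c_r_gt0 r1.
have cf := is_derive_continuous dfE.
pose u x := (f x - f 0) ^+ 2 * japan (r - 1) x.
have cu : continuous u.
  move=> x; apply: cvgM; last exact: continuous_japan.
  apply: (@continuous_sqr_comp _ (fun x => f x - f 0)) => y.
  by apply: cvgB; [exact: cf|exact: cvg_cst].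
have u0 x : 0 <= u x by rewrite mulr_ge0 ?sqr_ge0 ?ltW ?japan_gt0.
have H : (\int[mu1]_x (u x)%:E <= (hardy_cst * mean mu1 (fun x => df x ^+ 2))%:E)%E.
  apply: (le_trans (le_integral_japan cu u0)).
  have r12 : 1 <= r <= 2 by rewrite r1.
  have ce0 : (0 <= (c_r r * expR 1)%:E)%E by rewrite lee_fin mulr_ge0 ?expR_ge0// ltW.
  apply: (le_trans (lee_wpmul2l ce0 (hardy_japan r12 dfE cdf))).
  rewrite /hardy_cst [leRHS]EFinM -mean_EFin//.
  have cd2 : continuous (fun x => df x ^+ 2) by exact: continuous_sqr_comp.
  have := integral_japan_le cd2 (fun x => sqr_ge0 (df x)).
  set I := integral mu _ _; set J := integral mu1 _ _ => IJ.
  have -> : ((c_r r * expR 1)%:E * (256%:E * I) = (256 * expR 1)%:E * ((c_r r)%:E * I))%E.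
    by rewrite !muleA -!EFinM; congr (_%:E * _)%E; ring.
  by rewrite lee_wpmul2l// lee_fin mulr_ge0 ?expR_ge0.
have iu : meanable mu1 u.
  apply: meanable_fin => //; first exact: continuous_measurable_fun.
  exact: le_lt_trans H (ltry _).
by split=> //; rewrite -lee_fin -mean_EFin.
Qed.

End one_dim.

(** * The one-dimensional inequality *)

Section one_dim.
Context {R : realType} (r : R) (r1 : 1 <= r) (r2 : r <= 2).
Notation mu := (@lebesgue_measure R).
Notation P := (mu1 r1).
Notation K := (@hardy_cst R).

Lemma hardy_cst_ge1 : 1 <= K.
Proof. by have := @expR_ge1Dx R 1; rewrite /hardy_cst; lra. Qed.

(** The Hardy inequality for the identity function bounds the mean of [x^2] times the weight by [K].
    This dominates the weight where [x^2 >= 1]; elsewhere the weight is at most [1 + x^2 <= 2]. *)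
Lemma mean_japan : meanable P (japan (r - 1)) /\ mean P (japan (r - 1)) <= K + 2.
Proof.
have did (x : R) : is_derive x 1 (@id R) (cst 1 x) by exact: is_derive_id.
have i1 : meanable P (fun x => cst 1 x ^+ 2).
  by have := meanable_cst P (1 ^+ 2 : R).
have [iu mu_le] := hardy_mu1 r2 did (@cst_continuous _ _ _) i1.
have jle (x : R) : 0 <= japan (r - 1) x <= (x - 0) ^+ 2 * japan (r - 1) x + 2.
  move: (r1) (r2) => r1' r2'; have j0 := japan_gt0 (r - 1) x.
  rewrite ltW//= subr0; have [x1|x1] := leP 1 (x ^+ 2); first by nra.
  have : japan (r - 1) x <= japan 1 x by apply: japan_le; lra.
  rewrite japan1; have := sqr_ge0 x; nra.
have i2 := meanableD iu (meanable_cst P 2).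
have ij : meanable P (japan (r - 1)).
  apply: meanable_le i2; last exact: jle.
  by apply: continuous_measurable_fun; exact: continuous_japan.
split=> //; apply: (@le_trans _ _ (mean P (fun x => (x - 0) ^+ 2 * japan (r - 1) x + 2))).
  by apply: mean_le => // x; have /andP[] := jle x.
rewrite meanD//; last exact: meanable_cst.
rewrite mean_cst lerD2r; apply: (le_trans mu_le).
by rewrite (_ : (fun=> _) = fun=> 1) ?mean_cst ?mulr1//; apply/funext => x; rewrite expr1n.
Qed.

(** AM-GM gives [|f'| <= f'^2 exp (- W) / (2 c) + (c / 2) exp W]. Integrated between 0 and [x], the
    first term is at most [8 D / (2 c)], the 8 bounding [1 / c_r]. The second is at most
    [(c / 2) |x| exp (W x)], and [|x| <= exp (W x)]. *)
Lemma growth_mu1 (f df : R -> R) (c x : R) : 0 < c ->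
  (forall x : R, is_derive x 1 f (df x)) -> continuous df ->
  meanable P (fun x => df x ^+ 2) ->
  f x <= f 0 + 4 * mean P (fun x => df x ^+ 2) / c
         + c / 2 * expR (2 * japan (r / 2) x).
Proof.
move=> c0 dfE cdf idf; set D := mean _ _.
set W := japan (r / 2).
have cr0 := c_r_gt0 r1.
have cd2 : continuous (fun x => df x ^+ 2) by exact: continuous_sqr_comp.
pose w y := df y ^+ 2 * expR (- W y).
have cw : continuous w.
  by move=> y; apply: cvgM; [exact: cd2|exact: continuous_japan_expR].
have w0 y : 0 <= w y by rewrite mulr_ge0 ?sqr_ge0 ?expR_ge0.
have wD (A : set R) : measurable A -> (\int[mu]_(y in A) (w y)%:E <= (8 * D)%:E)%E.
  move=> mA; apply: (@le_trans _ _ (\int[mu]_y (w y)%:E)%E).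
    apply: ge0_subset_integral => //; first exact: measurable_fun_EFin_continuous.
    by move=> y _; rewrite lee_fin.
  have H := integral_japan_le r1 r2 cd2 (fun y => sqr_ge0 (df y)).
  rewrite mean_EFin// -/D in H.
  have {}H : (\int[mu]_y (w y)%:E <= ((c_r r)^-1 * D)%:E)%E.
    have cV0 : (0 <= ((c_r r)^-1)%:E)%E by rewrite lee_fin invr_ge0 ltW.
    have := lee_wpmul2l cV0 H.
    by rewrite muleA -!EFinM mulVf ?gt_eqF// mul1e.
  apply: (le_trans H); rewrite lee_fin ler_wpM2r//.
    by apply: mean_ge0 => y; exact: sqr_ge0.
  exact: invc_r_le.
pose v y := (2 * c)^-1 * w y + c / 2 * expR (W x).
have cv : continuous v.
  move=> y; apply: cvgD; last exact: cvg_cst.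
  by apply: cvgM; [exact: cvg_cst|exact: cw].
have Wmono y : `|y| <= `|x| -> W y <= W x.
  move: (r1) => r1' yx; rewrite /W /japan; apply: ge0_ler_powR; first lra.
  - by rewrite nnegrE ltW// japan_base_gt0.
  - by rewrite nnegrE ltW// japan_base_gt0.
  - by rewrite lerD2l -(real_normK (num_real y)) -(real_normK (num_real x)) ler_sqr ?nnegrE.
have dfv y : `|y| <= `|x| -> `|df y| <= v y.
  move=> yx.
  have e0 := expR_gt0 (W y).
  have le1 : c / 2 * expR (W y) <= c / 2 * expR (W x).
    by rewrite ler_pM2l ?divr_gt0// ler_expR Wmono.
  apply: (@le_trans _ _ ((2 * c)^-1 * w y + c / 2 * expR (W y))); last first.
    by rewrite lerD2l.
  rewrite /w expRN -(real_normK (num_real (df y))).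
  set e := expR (W y) in e0 *; set d := `|df y|.
  have : 0 <= (d - c * e) ^+ 2 / (2 * c * e).
    by rewrite divr_ge0 ?sqr_ge0// ltW// !mulr_gt0.
  have -> : (d - c * e) ^+ 2 / (2 * c * e) = (2 * c)^-1 * (d ^+ 2 / e) + c / 2 * e - d.
    by field; rewrite !gt_eqF.
  by rewrite subr_ge0.
have intv (a b : R) : a < b -> b - a = `|x| ->
    (\int[mu]_(y in `[a, b]) (v y)%:E <=
     (4 * D / c + c / 2 * (expR (W x) * `|x|))%:E)%E.
  move=> ab bax; under eq_integral do rewrite EFinD.
  rewrite integralD//; last 2 first.
  - by apply: integrable_continuous_cc => y; apply: cvgM; [exact: cvg_cst|exact: cw].
  - by apply: integrable_continuous_cc => y; exact: cvg_cst.
  rewrite EFinD; apply: leeD.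
    under eq_integral do rewrite EFinM.
    rewrite ge0_integralZl//; last 3 first.
    - exact: measurable_fun_EFin_continuous.
    - by move=> y _; rewrite lee_fin.
    - by rewrite lee_fin invr_ge0 mulr_ge0// ltW.
    have i0 : (0 <= ((2 * c)^-1)%:E)%E by rewrite lee_fin invr_ge0 mulr_ge0// ltW.
    apply: (le_trans (lee_wpmul2l i0 (wD _ (measurable_itv _)))).
    rewrite -EFinM lee_fin le_eqVlt; apply/orP; left; apply/eqP.
    by field; rewrite gt_eqF.
  rewrite integral_cst//= lebesgue_measure_itv/= lte_fin ab -EFinB bax.
  by rewrite -EFinM mulrA.
have xW : `|x| <= expR (W x).
  have h1 : `|x| <= W x.
    apply: (@le_trans _ _ (japan 2^-1 x)); last by apply: japan_le; move: (r1); lra.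
    rewrite -ler_sqr ?nnegrE ?(ltW (japan_gt0 _ _))//.
    rewrite real_normK ?num_real// [X in _ <= X]expr2 -japanD (_ : 2^-1 + 2^-1 = 1 :> R); last by lra.
    by rewrite japan1; lra.
  by have := expR_ge1Dx (W x); lra.
suff : f x - f 0 <= 4 * D / c + c / 2 * (expR (W x) * `|x|).
  have : c / 2 * (expR (W x) * `|x|) <= c / 2 * (expR (W x) * expR (W x)).
    by rewrite ler_pM2l ?divr_gt0// ler_pM2l// expR_gt0.
  rewrite -expRD (_ : W x + W x = 2 * W x); last by ring.
  lra.
have c0' : continuous (fun _ : R => 0 : R) by move=> y; exact: cvg_cst.
have D0 : 0 <= D by apply: mean_ge0 => y; exact: sqr_ge0.
have [x0|x0|->] := ltgtP x 0; last first.
- by rewrite subrr normr0 !mulr0 addr0 divr_ge0 ?mulr_ge0// ltW.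
- have H := @FTC_le _ f df (fun=> 0) v 0 x x0 dfE cdf c0' cv.
  rewrite -lee_fin; apply: le_trans (intv 0 x x0 _); last by rewrite subr0 gtr0_norm.
  apply: le_trans (H _); first by rewrite integral0 adde0.
  move=> y /andP[y0 yx]; rewrite addr0 (le_trans (ler_norm _))// dfv//.
  by rewrite !ger0_norm// (le_trans y0).
- have dNf (y : R) : is_derive y 1 (fun y => - f y) (- df y).
    by have d1 := dfE y; apply: is_derive_eq.
  have cNdf : continuous (fun y => - df y) by move=> y; apply: cvgN; exact: cdf.
  have H := @FTC_le _ (fun y => - f y) (fun y => - df y) (fun=> 0) v x 0 x0 dNf cNdf c0' cv.
  rewrite -lee_fin; apply: le_trans (intv x 0 x0 _); last by rewrite sub0r ltr0_norm.
  apply: le_trans (H _); first by rewrite integral0 adde0 opprK addrC.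
  move=> y /andP[yx y0]; rewrite addr0 (le_trans (ler_norm _))// normrN dfv//.
  by rewrite !ler0_norm// ?lerN2// (le_trans yx).
Qed.

End one_dim.

(** With [s = 2 - p], [min (1, s (B W + I))] is at most [min (1, s B W) + s I]. Only the first
    summand needs the power [a], since [s <= s^a]; and [B^a <= B] because [B >= 1]. Keeping [I]
    outside the power leaves it linear, so that its product with [c^2] is again the energy. *)
Lemma bregman_le_powR (R : realType) (p a t B W I : R) :
  1 <= p < 2 -> 0 <= a <= 1 -> 0 <= t -> 1 <= B -> 0 <= W -> 0 <= I ->
  1 + logp t <= B * W + I ->
  bregman p t <= 2 * (2 - p) `^ a * (B * W `^ a + I) * (t - 1) ^+ 2.
Proof.
move=> p12 a01 t0 B1 W0 I0 tBWI.
have s01 : 0 < 2 - p <= 1 by lra.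
have s0 : 0 <= 2 - p by lra.
have sBW0 : 0 <= (2 - p) * (B * W) by rewrite !mulr_ge0//; lra.
have H1 : bregman p t <= (t - 1) ^+ 2 by apply: bregman_le_sqr => //; lra.
have H2 := bregman_le_log p12 t0.
have t2 : 0 <= (t - 1) ^+ 2 by exact: sqr_ge0.
set m := (2 - p) `^ a * (B * W `^ a + I).
have m0 : Num.min 1 ((2 - p) * (B * W)) + (2 - p) * I <= m.
  rewrite /m mulrDr lerD//.
    apply: (le_trans (minr_le_powR a01 sBW0)).
    have B0 : 0 <= B by lra.
    rewrite powRM ?mulr_ge0// powRM// ler_wpM2l ?powR_ge0// ler_wpM2r ?powR_ge0//.
    by apply: ler1_powR => //; lra.
  by rewrite ler_wpM2r// ger1_powR//; lra.
suff : bregman p t <= 2 * m * (t - 1) ^+ 2 by rewrite /m mulrA.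
have [h|h] := leP 1 ((2 - p) * (B * W)).
  rewrite min_l// in m0.
  have sI : 0 <= (2 - p) * I by rewrite mulr_ge0.
  have m1 : 1 <= m by lra.
  by apply: (le_trans H1); nra.
rewrite min_r ?(ltW h)// in m0.
apply: (le_trans H2); rewrite ler_wpM2r// ler_pM2l//.
apply: le_trans m0; rewrite -mulrDr ler_wpM2l//.
Qed.

Lemma meanable_powR d (T : measurableType d) (R : realType) (P : probability T R)
    (f : T -> R) (p : R) : 1 <= p <= 2 -> measurable_fun setT f ->
  (forall x, 0 <= f x) -> meanable P (fun x => f x ^+ 2) ->
  meanable P (fun x => f x `^ p).
Proof.
move=> /andP[p1 p2] mf f0 if2.
apply: meanable_le (meanableD (meanable_cst P 1) if2).
  exact: (measurableT_comp (@measurable_powR R p)).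
move=> x; rewrite powR_ge0/=.
have [fx1|fx1] := leP 1 (f x).
  have : f x `^ p <= f x `^ 2%:R by apply: ler_powR.
  by rewrite powR_mulrn//; lra.
have [->|fn0] := eqVneq (f x) 0.
  by rewrite powR0 ?gt_eqF// ?expr0n ?addr0//; lra.
have : f x `^ p <= f x.
  by apply: ge1r_powR => //; rewrite lt_neqAle eq_sym fn0 f0 ltW.
have := sqr_ge0 (f x); lra.
Qed.

Section one_dim.
Context {R : realType}.
Notation K := (@hardy_cst R).

(** [K (2 K + 6)] bounds the weighted mean of [(f - c)^2] in units of the energy, [K + 10] is the
    coefficient of [W] in the logarithmic bound, the summand 2 comes from [E (f - c)^2 <= 2 c^2],
    and the outer 2 from the Bregman estimate. *)
Definition beckner_cst : R := 2 * ((K + 10) * (K * (2 * K + 6)) + 2).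

Lemma beckner_cst_gt0 : 0 < beckner_cst.
Proof.
have K1 := @hardy_cst_ge1 R; rewrite mulr_gt0// addr_gt0// !mulr_gt0//; lra.
Qed.

Lemma beckner_real (r a p : R) (r1 : 1 <= r) (f df : R -> R) :
  r <= 2 -> 0 <= a <= 1 -> r / 2 * a = r - 1 -> 1 <= p < 2 ->
  (forall x : R, is_derive x 1 f (df x)) -> continuous df ->
  (forall x, 0 <= f x) ->
  meanable (mu1 r1) (fun x => f x ^+ 2) ->
  meanable (mu1 r1) (fun x => df x ^+ 2) ->
  mean (mu1 r1) (fun x => f x ^+ 2) <=
  mean (mu1 r1) (fun x => f x `^ p) `^ (2 / p) +
  beckner_cst * (2 - p) `^ a * mean (mu1 r1) (fun x => df x ^+ 2).
Proof.
move=> r2 a01 ra p12 dfE cdf f0 if2 idf.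
set P := mu1 r1.
have K1 := @hardy_cst_ge1 R.
have cf := is_derive_continuous dfE.
have mf : measurable_fun [set: measurableTypeR R] f by exact: continuous_measurable_fun.
set D := mean P (fun x => df x ^+ 2).
have D0 : 0 <= D by apply: mean_ge0 => x; exact: sqr_ge0.
set S := mean P (fun x => f x ^+ 2).
have S0 : 0 <= S by apply: mean_ge0 => x; exact: sqr_ge0.
have sa0 : 0 <= (2 - p) `^ a by exact: powR_ge0.
have C0 := beckner_cst_gt0.
have [->|Sn0] := eqVneq S 0.
  by rewrite addr_ge0 ?powR_ge0//; apply: mulr_ge0 => //; apply: mulr_ge0 => //; exact: ltW.
pose c := Num.sqrt S.
have c0 : 0 < c by rewrite sqrtr_gt0 lt_neqAle eq_sym Sn0.
have c2 : c ^+ 2 = S by rewrite sqr_sqrtr.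
set W := japan (r / 2); set R2 := japan (r - 1).
have W1 x : 1 <= W x by apply: japan_ge1; lra.
have R21 x : 1 <= R2 x by apply: japan_ge1; lra.
have WR2 x : W x `^ a = R2 x by rewrite /W /R2 /japan -powRrM ra.
pose I := D / c ^+ 2.
have I0 : 0 <= I by rewrite divr_ge0 ?sqr_ge0.
have DI : D = I * c ^+ 2 by rewrite divfK// gt_eqF// exprn_gt0.
have [iH mH] := hardy_mu1 r2 dfE cdf idf.
have [iR2 mR2] := mean_japan r1 r2.
rewrite -/R2 in iH mH iR2 mR2; rewrite -/D in mH.
(* |c - f 0| <= |f - f 0|_2, as c = |f|_2 *)
have m1 : meanable P (fun x => (f x - f 0) ^+ 2).
  apply: meanable_le iH; first by apply: measurable_funX; exact: measurable_funB.
  by move=> x; rewrite sqr_ge0 ler_peMr ?sqr_ge0.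
have M1 : mean P (fun x => (f x - f 0) ^+ 2) <= K * D.
  apply: le_trans mH; apply: mean_le => // x; by rewrite ler_peMr ?sqr_ge0.
have cf0 : (f 0 - c) ^+ 2 <= K * D.
  have iz := meanableZ (f 0 / c) if2.
  have ik := meanable_cst P (f 0 * c).
  have ik2 := meanable_cst P (f 0 ^+ 2).
  have H : mean P (fun x => f x ^+ 2 + f 0 ^+ 2) <=
     mean P (fun x => (f x - f 0) ^+ 2 + (f 0 / c * f x ^+ 2 + f 0 * c)).
    apply: mean_le.
    - exact: meanableD.
    - by apply: meanableD => //; exact: meanableD.
    (* AM-GM in place of Cauchy-Schwarz: [2 f (f 0) <= (f 0 / c) f^2 + f 0 * c], whose right side
       has mean [2 c (f 0)]. *)
    - move=> x; have : 0 <= f 0 / c * (f x - c) ^+ 2 by rewrite mulr_ge0 ?sqr_ge0 ?divr_ge0// ltW.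
      have -> : f 0 / c * (f x - c) ^+ 2 = f 0 / c * f x ^+ 2 + f 0 * c - 2 * f x * f 0.
        by field; rewrite gt_eqF.
      by rewrite sqrrB; lra.
  rewrite (meanD if2 ik2) (meanD m1 (meanableD iz ik)) (meanD iz ik) (meanZ _ if2) !mean_cst in H.
  rewrite -/S -c2 in H.
  have E : f 0 / c * c ^+ 2 = f 0 * c by field; rewrite gt_eqF.
  rewrite E in H; rewrite sqrrB; lra.
have fc2 x : (f x - c) ^+ 2 <= 2 * (f x - f 0) ^+ 2 + 2 * (f 0 - c) ^+ 2.
  have := sqr_ge0 ((f x - f 0) - (f 0 - c)).
  rewrite [X in _ <= X -> _](_ : _ = 2 * (f x - f 0) ^+ 2 + 2 * (f 0 - c) ^+ 2 - (f x - c) ^+ 2).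
    by rewrite subr_ge0.
  by ring.
have mfc2 : measurable_fun [set: measurableTypeR R] (fun x => (f x - c) ^+ 2).
  by apply: measurable_funX; exact: measurable_funB.
have mR : measurable_fun [set: measurableTypeR R] R2.
  by apply: continuous_measurable_fun; exact: continuous_japan.
have dom x : 0 <= (f x - c) ^+ 2 * R2 x <=
    2 * ((f x - f 0) ^+ 2 * R2 x) + 2 * (f 0 - c) ^+ 2 * R2 x.
  rewrite mulr_ge0 ?sqr_ge0 ?(le_trans _ (R21 x))//=.
  have := ler_wpM2r (le_trans ler01 (R21 x)) (fc2 x); lra.
have iZ1 := meanableZ 2 iH; have iZ2 := meanableZ (2 * (f 0 - c) ^+ 2) iR2.
have iR : meanable P (fun x => (f x - c) ^+ 2 * R2 x).
  apply: (meanable_le _ _ (meanableD iZ1 iZ2)); last exact: dom.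
  exact: measurable_funM.
have MR : mean P (fun x => (f x - c) ^+ 2 * R2 x) <= K * (2 * K + 6) * D.
  have : mean P (fun x => (f x - c) ^+ 2 * R2 x) <=
    mean P (fun x => 2 * ((f x - f 0) ^+ 2 * R2 x) + 2 * (f 0 - c) ^+ 2 * R2 x).
    apply: mean_le => //; first exact: meanableD.
    by move=> x; have /andP[] := dom x.
  rewrite (meanD iZ1 iZ2) (meanZ _ iH) (meanZ _ iR2).
  have h : (f 0 - c) ^+ 2 * mean P R2 <= K * D * (K + 2).
    apply: (ler_pM _ _ cf0 mR2); first exact: sqr_ge0.
    by apply: mean_ge0 => x; exact: le_trans (R21 x).
  lra.
have dom2 x : 0 <= (f x - c) ^+ 2 <= f x ^+ 2 + c ^+ 2.
  rewrite sqr_ge0/= sqrrB; have : 0 <= f x * c by rewrite mulr_ge0// ltW.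
  lra.
have i2 : meanable P (fun x => (f x - c) ^+ 2).
  apply: (meanable_le mfc2 _ (meanableD if2 (meanable_cst P (c ^+ 2)))).
  exact: dom2.
have M2 : mean P (fun x => (f x - c) ^+ 2) <= 2 * c ^+ 2.
  have : mean P (fun x => (f x - c) ^+ 2) <= mean P (fun x => f x ^+ 2 + c ^+ 2).
    apply: mean_le => //; first by apply: meanableD => //; exact: meanable_cst.
    by move=> x; have /andP[] := dom2 x.
  rewrite (meanD if2 (meanable_cst P _)).
  by rewrite mean_cst -/S -c2; lra.
(* The growth bound and [f 0 / c <= 3/2 + K I / 2] give [f x / c <= (K + 8) (1 + I) exp (2 W)]. The
   logarithm of this is at most [K + 7 + I + 2 W], and [W >= 1] turns the constants into multiples
   of [W]. *)
have lgt x : 1 + logp (f x / c) <= (K + 10) * W x + I.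
  have G := growth_mu1 r2 x c0 dfE cdf idf; rewrite -/D -/W in G.
  set e := expR (2 * W x) in G.
  have e1 : 1 <= e by have := expR_ge1Dx (2 * W x); have := W1 x; rewrite /e; lra.
  have f0c : f 0 / c <= 3 / 2 + K / 2 * I.
    have : (f 0 / c - 1) ^+ 2 <= K * I.
      have -> : (f 0 / c - 1) ^+ 2 = (f 0 - c) ^+ 2 / c ^+ 2 by field; rewrite gt_eqF.
      by rewrite ler_pdivrMr ?exprn_gt0// -mulrA -DI.
    have := sqr_ge0 (f 0 / c - 1 - 1); nra.
  have fc : f x / c <= (K + 8) * (1 + I) * e.
    have : f x / c <= f 0 / c + 4 * I + e / 2.
      rewrite ler_pdivrMr// (le_trans G)// le_eqVlt; apply/orP; left; apply/eqP.
      by rewrite /I; field; rewrite gt_eqF.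
    have h : K / 2 * I + 4 * I + 3 / 2 + 1 / 2 <= (K + 8) * (1 + I) by nra.
    have h0 : 0 <= K / 2 * I + 4 * I + 3 / 2.
      have : 0 <= K * I by apply: mulr_ge0 => //; lra.
      lra.
    have h1 : (K / 2 * I + 4 * I + 3 / 2) * 1 <= (K / 2 * I + 4 * I + 3 / 2) * e.
      by rewrite ler_wpM2l.
    have := ler_wpM2r (le_trans ler01 e1) h; lra.
  have K8 : 1 <= K + 8 by lra.
  have I1 : 1 <= 1 + I by lra.
  have fc1 : Num.max 1 (f x / c) <= (K + 8) * (1 + I) * e.
    by rewrite ge_max fc andbT !mulr_ege1.
  have : logp (f x / c) <= ln ((K + 8) * (1 + I) * e).
    rewrite ler_ln// ?posrE ?mulr_gt0//; try lra.
    by rewrite lt_max ltr01.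
  rewrite lnM ?posrE ?mulr_gt0 ?expR_gt0//; try lra.
  rewrite lnM ?posrE//; try lra.
  rewrite expRK.
  have := @le_ln1Dx R I; have := @le_ln1Dx R (K + 7).
  rewrite (_ : 1 + (K + 7) = K + 8); last by ring.
  move=> /(_ ltac:(lra)) h1 /(_ ltac:(lra)) h2.
  have := W1 x; nra.
set sa := (2 - p) `^ a in sa0 *.
(* [k] is the slope of [x^(2/p)] at [c^p]. *)
set k := 2 / p * c `^ (2 - p).
have p0 : 0 < p by lra.
have cp2 : c `^ p * c `^ (2 - p) = c ^+ 2.
  rewrite -powRD; last by rewrite (gt_eqF c0) implybT.
  by rewrite addrC subrK powR_mulrn// ltW.
have key x : f x ^+ 2 + k * c `^ p <= k * f x `^ p + c ^+ 2 +
   (2 * sa * (K + 10) * ((f x - c) ^+ 2 * R2 x) + 2 * sa * I * (f x - c) ^+ 2).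
  have t0 : 0 <= f x / c by rewrite divr_ge0// ltW.
  have B1 : 1 <= K + 10 by lra.
  have := bregman_le_powR p12 a01 t0 B1 (le_trans ler01 (W1 x)) I0 (lgt x).
  rewrite WR2 -/sa -(ler_pM2l (exprn_gt0 2 c0)).
  have -> : c ^+ 2 * bregman p (f x / c) = f x ^+ 2 - c ^+ 2 - k * (f x `^ p - c `^ p).
    have fxE : f x `^ p = c `^ p * (f x / c) `^ p.
      rewrite -powRM ?(ltW c0)//; congr (_ `^ p); by field; rewrite gt_eqF.
    rewrite /bregman fxE /k.
    have -> : c `^ p * (f x / c) `^ p - c `^ p = c `^ p * ((f x / c) `^ p - 1) by ring.
    rewrite [2 / p * c `^ (2 - p) * _](_ : _ = 2 / p * (c `^ p * c `^ (2 - p)) * ((f x / c) `^ p - 1)); last by ring.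
    by rewrite cp2; field; rewrite !gt_eqF.
  have -> : c ^+ 2 * (2 * sa * ((K + 10) * R2 x + I) * (f x / c - 1) ^+ 2) =
    2 * sa * (K + 10) * ((f x - c) ^+ 2 * R2 x) + 2 * sa * I * (f x - c) ^+ 2.
    by field; rewrite gt_eqF.
  lra.
have ifp : meanable P (fun x => f x `^ p).
  by apply: meanable_powR => //; lra.
set m := mean P (fun x => f x `^ p).
have m0 : 0 <= m by apply: mean_ge0 => x; exact: powR_ge0.
have MK : S + k * c `^ p <= k * m + c ^+ 2 +
   (2 * sa * (K + 10) * mean P (fun x => (f x - c) ^+ 2 * R2 x)
    + 2 * sa * I * mean P (fun x => (f x - c) ^+ 2)).
  have j1 := meanableZ k ifp.
  have j2 := meanableZ (2 * sa * (K + 10)) iR.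
  have j3 := meanableZ (2 * sa * I) i2.
  have j4 := meanableD j2 j3.
  have j5 := meanableD j1 (meanable_cst P (c ^+ 2)).
  have := mean_le (meanableD if2 (meanable_cst P (k * c `^ p))) (meanableD j5 j4) key.
  rewrite meanD//; last exact: meanable_cst.
  rewrite mean_cst meanD// meanD//; last exact: meanable_cst.
  by rewrite mean_cst meanD// !meanZ.
have q1 : 1 <= 2 / p by rewrite ler_pdivlMr//; lra.
(* The tangent of [x^(2/p)] at [c^p], evaluated at [m]: [c^2 + k (m - c^p) <= m^(2/p)]. *)
have := powR_tangent m0 (powR_ge0 c p) q1.
rewrite -!powRrM (_ : p * (2 / p) = 2%:R); last by field; rewrite gt_eqF.
rewrite (_ : p * (2 / p - 1) = 2 - p); last by field; rewrite gt_eqF.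
rewrite powR_mulrn ?(ltW c0)// -/k => T.
have h1 : 2 * sa * (K + 10) * mean P (fun x => (f x - c) ^+ 2 * R2 x) <=
  2 * sa * (K + 10) * (K * (2 * K + 6) * D).
  by rewrite ler_wpM2l// !mulr_ge0//; lra.
have h2 : 2 * sa * I * mean P (fun x => (f x - c) ^+ 2) <= 2 * sa * I * (2 * c ^+ 2).
  by apply: ler_wpM2l => //; apply: mulr_ge0 => //; exact: mulr_ge0.
have -> : beckner_cst * sa * D =
  2 * sa * (K + 10) * (K * (2 * K + 6) * D) + 2 * sa * I * (2 * c ^+ 2).
  have -> : 2 * sa * I * (2 * c ^+ 2) = 4 * sa * (I * c ^+ 2) by ring.
  by rewrite -DI /beckner_cst; ring.
lra.
Qed.

End one_dim.

(** * Tensorisation *)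

(** The four-point inequality for [G/m], [A/m], [B/m]. The scale [m] stays free because the mean of
    [G], its natural value, may be 0. *)
Lemma powR_four_point_scaled (R : realType) (q m G A B : R) :
  1 < q <= 2 -> 0 < m -> 0 <= G -> 0 <= A -> 0 <= B ->
  q * (A `^ (q - 1) * G) + q * (B `^ (q - 1) * G)
    + q * (q - 1) * m `^ (q - 1) * A + q * (q - 1) * m `^ (q - 1) * B
    + (q - 1) * m `^ q
  <= G `^ q + (q - 1) * A `^ q + (q - 1) * B `^ q + q * m `^ (q - 1) * G
     + q * (q - 1) * m `^ (q - 2) * (A * B) + q * (q - 1) * m `^ q.
Proof.
move=> q12 m0 G0 A0 B0; have q0 : 0 < q by lra.
have := powR_four_point q12 (divr_ge0 G0 (ltW m0)) (divr_ge0 A0 (ltW m0))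
  (divr_ge0 B0 (ltW m0)).
have mq : m `^ q = m * m `^ (q - 1) by rewrite mulr_powRB1// ltW.
have mq2 : m `^ (q - 2) = m `^ (q - 1) / m.
  rewrite (_ : q - 2 = (q - 1) - 1); last by ring.
  rewrite powRB ?powRr1 ?(ltW m0)//; last by rewrite (gt_eqF m0) implybT.
have E x t : 0 <= x -> x `^ t = m `^ t * (x / m) `^ t.
  move=> x0; rewrite -powRM ?(ltW m0) ?divr_ge0 ?(ltW m0)//; congr (_ `^ t).
  by field; rewrite gt_eqF.
rewrite (E A (q - 1))// (E B (q - 1))// (E A q)// (E B q)// (E G q)//.
rewrite -(ler_pM2l (powR_gt0 q m0)) mq2 mq.
set Gq := (G / m) `^ q; set Aq := (A / m) `^ q; set Bq := (B / m) `^ q.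
set A' := (A / m) `^ (q - 1); set B' := (B / m) `^ (q - 1).
set mm := m `^ (q - 1); move=> H.
have -> : q * (mm * A' * G) + q * (mm * B' * G) + q * (q - 1) * mm * A +
   q * (q - 1) * mm * B + (q - 1) * (m * mm) =
   m * mm * (q * A' * (G / m) + q * B' * (G / m) + (q - 1) +
      q * (q - 1) * (A / m + B / m)) by field; rewrite gt_eqF.
apply: (le_trans H); rewrite le_eqVlt; apply/orP; left; apply/eqP.
by field; rewrite gt_eqF.
Qed.

Section tensor.
Local Open Scope ereal_scope.
Context d1 d2 (T1 : measurableType d1) (T2 : measurableType d2) (R : realType).
Context (m1 : probability T1 R) (m2 : probability T2 R).

Lemma integral_cst_prob d (T : measurableType d) (P : probability T R) (k : \bar R) :
  \int[P]_x (cst k x) = k.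
Proof. by rewrite integral_cst// [X in _ * X](@probability_setT _ _ _ P) mule1. Qed.

Lemma jensen_powR d (T : measurableType d) (P : probability T R) (g : T -> R)
    (q : R) : (1 < q)%R -> measurable_fun setT g -> (forall x, (0 <= g x)%R) ->
  ((fine (\int[P]_x (g x)%:E)) `^ q)%:E <= \int[P]_x (g x `^ q)%:E.
Proof.
move=> q1 mg g0; set A := fine _.
have I0 : 0 <= \int[P]_x (g x)%:E by apply: integral_ge0 => x _; rewrite lee_fin.
have A0 : (0 <= A)%R by exact: fine_ge0.
have q0 : (0 < q)%R by lra.
(* If [g] has infinite mean, [fine] returns 0 and the left side is 0. *)
have [fin|nfin] := boolP (\int[P]_x (g x)%:E \is a fin_num); last first.
  have -> : A = 0%R by move: nfin; rewrite /A; case: (\int[P]_x _).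
  rewrite powR0 ?gt_eqF//; apply: integral_ge0 => x _; rewrite lee_fin powR_ge0//.
have key x : (q * A `^ (q - 1) * g x <= g x `^ q + (q - 1) * A `^ q)%R.
  have := powR_tangent (g0 x) A0 (ltW q1).
  by rewrite mulrBr -(@mulr_powRB1 _ A q)// [(A * _)%R]mulrC; lra.
have mgq : measurable_fun setT (fun x => g x `^ q)%R.
  exact: (measurableT_comp (@measurable_powR R q)).
have : \int[P]_x ((q * A `^ (q - 1))%:E * (g x)%:E) <=
    \int[P]_x ((g x `^ q)%:E + ((q - 1) * A `^ q)%:E).
  apply: ge0_le_integral => //.
  - by move=> x _; rewrite -EFinM lee_fin !mulr_ge0 ?powR_ge0// ltW.
  - by apply: measurable_funeM; exact/measurable_EFinP.
  - apply/measurable_EFinP; exact: measurable_funD.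
  - by move=> x _; rewrite -EFinM -EFinD lee_fin.
rewrite ge0_integralZl//; last 3 first.
- exact/measurable_EFinP.
- by move=> x _; rewrite lee_fin.
- by rewrite lee_fin mulr_ge0 ?powR_ge0// ltW.
rewrite ge0_integralD//; last 3 first.
- by move=> x _; rewrite lee_fin powR_ge0.
- exact/measurable_EFinP.
- by move=> x _; rewrite lee_fin mulr_ge0 ?powR_ge0//; lra.
rewrite integral_cst_prob -(fineK fin) -/A -EFinM.
rewrite -mulrA [(_ `^ (q - 1) * A)%R]mulrC mulr_powRB1//.
rewrite -leeBlDr// -EFinB; congr (_ <= _); congr EFin; ring.
Qed.

Notation PP := (m1 \x m2).

Lemma integral_fst (u : T1 -> \bar R) : measurable_fun setT u ->
  (forall x, 0 <= u x) -> \int[PP]_z u z.1 = \int[m1]_x u x.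
Proof.
move=> mu u0; rewrite fubini_tonelli1//=; last exact: (measurableT_comp mu).
by apply: eq_integral => x _; rewrite /fubini_F/= integral_cst_prob.
Qed.

Lemma integral_snd (u : T2 -> \bar R) : measurable_fun setT u ->
  (forall y, 0 <= u y) -> \int[PP]_z u z.2 = \int[m2]_y u y.
Proof.
move=> mu u0; rewrite fubini_tonelli2//=; last exact: (measurableT_comp mu).
by apply: eq_integral => x _; rewrite /fubini_G/= integral_cst_prob.
Qed.

Lemma mean_fst (u : T1 -> R) : measurable_fun setT u -> (forall x, (0 <= u x)%R) ->
  meanable m1 u -> meanable PP (fun z => u z.1) /\ mean PP (fun z => u z.1) = mean m1 u.
Proof.
move=> mu u0 iu.
have H : \int[PP]_z (u z.1)%:E = (mean m1 u)%:E.
  by rewrite (@integral_fst (fun x => (u x)%:E)) ?mean_EFin//; exact/measurable_EFinP.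
have i : meanable PP (fun z => u z.1).
  by apply: meanable_fin => //; [exact: (measurableT_comp mu)|rewrite H ltry].
by split=> //; apply: EFin_inj; rewrite -mean_EFin.
Qed.

Lemma mean_snd (u : T2 -> R) : measurable_fun setT u -> (forall x, (0 <= u x)%R) ->
  meanable m2 u -> meanable PP (fun z => u z.2) /\ mean PP (fun z => u z.2) = mean m2 u.
Proof.
move=> mu u0 iu.
have H : \int[PP]_z (u z.2)%:E = (mean m2 u)%:E.
  by rewrite (@integral_snd (fun x => (u x)%:E)) ?mean_EFin//; exact/measurable_EFinP.
have i : meanable PP (fun z => u z.2).
  by apply: meanable_fin => //; [exact: (measurableT_comp mu)|rewrite H ltry].
by split=> //; apply: EFin_inj; rewrite -mean_EFin.
Qed.

Section partial_means.
Context (G : T1 * T2 -> R) (q : R).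
Hypothesis q12 : (1 < q <= 2)%R.
Hypothesis mG : measurable_fun setT G.
Hypothesis G0 : forall z, (0 <= G z)%R.
Hypothesis iG : meanable PP (fun z => G z `^ q)%R.

Let mE : measurable_fun setT (fun z => (G z)%:E).
Proof. exact/measurable_EFinP. Qed.

Let E0 z : 0 <= (G z)%:E. Proof. by rewrite lee_fin. Qed.

Let mGq : measurable_fun setT (fun z => G z `^ q)%R.
Proof. exact: (measurableT_comp (@measurable_powR R q)). Qed.

Let A y : R := mean m1 (fun x => G (x, y)).
Let B x : R := mean m2 (fun y => G (x, y)).

Let mA : measurable_fun setT A.
Proof.
apply: (@measurableT_comp _ _ _ _ _ _ fine) => //.
exact: (@measurable_fun_fubini_tonelli_G _ _ _ _ _ m1 _ mE E0).
Qed.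

Let A0 y : (0 <= A y)%R. Proof. exact: mean_ge0. Qed.

Let powA : measurable_fun setT (fun y => A y `^ q)%R.
Proof. exact: (measurableT_comp (@measurable_powR R q)). Qed.

Let jensenA : \int[m2]_y (A y `^ q)%:E <= \int[PP]_z (G z `^ q)%:E.
Proof.
rewrite fubini_tonelli2//=; last 2 first.
- by apply/measurable_EFinP.
- by move=> z; rewrite lee_fin powR_ge0.
apply: ge0_le_integral => //.
- by move=> y _; rewrite lee_fin powR_ge0.
- exact/measurable_EFinP.
- apply: measurable_fun_fubini_tonelli_G; first exact/measurable_EFinP.
  by move=> z; rewrite lee_fin powR_ge0.
- move=> y _; apply: jensen_powR => //; first by case/andP: q12.
  exact: (measurableT_comp mG).
Qed.

Lemma meanable_partial_powR : meanable m2 (fun y => A y `^ q)%R.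
Proof.
apply: meanable_fin => //; first by move=> y; exact: powR_ge0.
by rewrite (le_lt_trans jensenA)// mean_EFin// ltry.
Qed.

Lemma meanable_base : meanable PP G.
Proof.
case/andP: q12 => q1 q2.
apply: (meanable_le _ _ (meanableD iG (meanable_cst PP 1%R))) => //.
move=> z; rewrite G0/=; have [z1|z1] := leP 1%R (G z).
  by have := le1r_powR z1 (ltW q1); lra.
by have := powR_ge0 (G z) q; lra.
Qed.

(** [A] is a [fine] value, hence 0 where the inner integral diverges. Since [G] is integrable over
    the product, this happens only on a null set. *)
Lemma partial_mean_fin : {ae m2, forall y, \int[m1]_x (G (x, y))%:E = (A y)%:E}.
Proof.
have i : m2.-integrable setT (fun y => \int[m1]_x (G (x, y))%:E).
  apply/integrableP; split; first exact: (@measurable_fun_fubini_tonelli_G _ _ _ _ _ m1 _ mE E0).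
  under eq_integral do rewrite gee0_abs ?integral_ge0//.
  rewrite -(fubini_tonelli2 _ mE E0) mean_EFin ?ltry//; exact: meanable_base.
have := integrable_ae measurableT i; apply: filterS => y /(_ I) h.
by rewrite /A /mean /Rintegral fineK.
Qed.

Lemma mean_partial : meanable m2 A /\ mean m2 A = mean PP G.
Proof.
have H : \int[m2]_y (A y)%:E = (mean PP G)%:E.
  rewrite -mean_EFin; last exact: meanable_base.
  rewrite fubini_tonelli2//=; apply: ge0_ae_eq_integral => //.
  - exact/measurable_EFinP.
  - exact: (@measurable_fun_fubini_tonelli_G _ _ _ _ _ m1 _ mE E0).
  - by move=> y _; rewrite lee_fin.
  - by move=> y _; apply: integral_ge0 => x _; rewrite lee_fin.
  - by apply: filterS partial_mean_fin => y h _; exact: esym h.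
have i : meanable m2 A by apply: meanable_fin => //; rewrite H ltry.
by split=> //; apply: EFin_inj; rewrite -mean_EFin.
Qed.

Lemma mean_partialM : meanable PP (fun z => A z.2 `^ (q - 1) * G z)%R /\
  mean PP (fun z => A z.2 `^ (q - 1) * G z)%R = mean m2 (fun y => A y `^ q)%R.
Proof.
case/andP: q12 => q1 q2.
have mA1 : measurable_fun setT (fun y => A y `^ (q - 1))%R.
  exact: (measurableT_comp (@measurable_powR R (q - 1))).
have mAG : measurable_fun setT (fun z => A z.2 `^ (q - 1) * G z)%R.
  by apply: measurable_funM => //; exact: (measurableT_comp mA1).
have H : \int[PP]_z (A z.2 `^ (q - 1) * G z)%:E = (mean m2 (fun y => A y `^ q)%R)%:E.
  rewrite -mean_EFin; last exact: meanable_partial_powR.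
  rewrite fubini_tonelli2//=; last 2 first.
  - exact/measurable_EFinP.
  - by move=> z; rewrite lee_fin mulr_ge0 ?powR_ge0.
  apply: eq_integral => y _; rewrite /fubini_G/=.
  under eq_integral do rewrite EFinM.
  rewrite ge0_integralZl//; last 2 first.
  - by apply/measurable_EFinP; exact: (measurableT_comp mG).
  - by rewrite lee_fin powR_ge0.
  have q0 : (0 < q)%R by lra.
  rewrite -(@mulr_powRB1 _ (A y) q)// mulrC.
  have [fin|nfin] := boolP (\int[m1]_x (G (x, y))%:E \is a fin_num).
    by rewrite /A /mean /Rintegral EFinM fineK.
  (* Where the inner integral is infinite, [A y] is 0 by default, and so is [A y^(q-1)] since
     [q > 1]; both sides are then 0, and the identity holds for every [y]. *)
  have -> : A y = 0%R.
    by move: nfin; rewrite /A /mean /Rintegral; case: (\int[m1]_x _).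
  rewrite powR0 ?mul0e ?mul0r// subr_eq0 gt_eqF//.
have i : meanable PP (fun z => A z.2 `^ (q - 1) * G z)%R.
  apply: meanable_fin => //; last by rewrite H ltry.
  by move=> z; rewrite mulr_ge0 ?powR_ge0.
by split=> //; apply: EFin_inj; rewrite -mean_EFin.
Qed.

End partial_means.

End tensor.

Section tensorisation.
Local Open Scope ereal_scope.
Context d1 d2 (T1 : measurableType d1) (T2 : measurableType d2) (R : realType).
Context (m1 : probability T1 R) (m2 : probability T2 R).
Notation PP := (m1 \x m2).

Lemma measurable_fun_swap (u : T1 * T2 -> R) : measurable_fun setT u ->
  measurable_fun setT (fun w : T2 * T1 => u (w.2, w.1)).
Proof.
move=> mu; apply: (measurableT_comp mu).
by apply/measurable_fun_pairP; split; [exact: measurable_snd|exact: measurable_fst].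
Qed.

Lemma integral_swap (u : T1 * T2 -> R) : measurable_fun setT u ->
  (forall z, (0 <= u z)%R) ->
  \int[m2 \x m1]_w (u (w.2, w.1))%:E = \int[PP]_z (u z)%:E.
Proof.
move=> mu u0.
rewrite (@fubini_tonelli2 _ _ _ _ _ m2 m1 (fun w => (u (w.2, w.1))%:E)); last 2 first.
- by apply/measurable_EFinP; exact: measurable_fun_swap.
- by move=> w; rewrite lee_fin.
by rewrite fubini_tonelli1//; exact/measurable_EFinP.
Qed.

Lemma mean_swap (u : T1 * T2 -> R) : measurable_fun setT u ->
  (forall z, (0 <= u z)%R) ->
  mean (m2 \x m1) (fun w => u (w.2, w.1)) = mean PP u.
Proof. by move=> mu u0; rewrite /mean /Rintegral integral_swap. Qed.

Lemma meanable_swap (u : T1 * T2 -> R) : measurable_fun setT u ->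
  (forall z, (0 <= u z)%R) ->
  meanable PP u <-> meanable (m2 \x m1) (fun w => u (w.2, w.1)).
Proof.
move=> mu u0; split=> iu; apply: meanable_fin => //.
- exact: measurable_fun_swap.
- by rewrite integral_swap// mean_EFin// ltry.
- by rewrite -integral_swap// mean_EFin// ltry.
Qed.

Lemma tensor_powR (G : T1 * T2 -> R) (q : R) : (1 < q <= 2)%R ->
  measurable_fun setT G -> (forall z, (0 <= G z)%R) ->
  meanable PP (fun z => G z `^ q)%R ->
  (mean m2 (fun y => mean m1 (fun x => G (x, y)) `^ q) +
   mean m1 (fun x => mean m2 (fun y => G (x, y)) `^ q) <=
   mean PP (fun z => G z `^ q) + mean PP G `^ q)%R.
Proof.
move=> q12 mG G0 iG.
pose A y : R := mean m1 (fun x => G (x, y)).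
pose B x : R := mean m2 (fun y => G (x, y)).
change (mean m2 (fun y => A y `^ q) + mean m1 (fun x => B x `^ q) <=
  mean PP (fun z => G z `^ q) + mean PP G `^ q)%R.
have [q1 q2] := andP q12.
have q0 : (0 < q)%R by exact: lt_trans q1.
have mGq : measurable_fun setT (fun z => G z `^ q)%R.
  exact: (measurableT_comp (@measurable_powR R q)).
have Gq0 z : (0 <= G z `^ q)%R by exact: powR_ge0.
(* Exchanging the two factors turns the lemmas on [A] into statements on [B]. *)
have mG' := measurable_fun_swap mG.
have G'0 w : (0 <= G (w.2, w.1))%R by [].
have iG' := (meanable_swap mGq Gq0).1 iG.
have iGM := meanable_base q12 mG G0 iG.
have [iA MA] := mean_partial q12 mG G0 iG.
have iAq := meanable_partial_powR q12 mG G0 iG.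
have [iAG MAG] := mean_partialM q12 mG G0 iG.
have [iB MB] := mean_partial q12 mG' G'0 iG'.
have iBq := meanable_partial_powR q12 mG' G'0 iG'.
have [iBG MBG] := mean_partialM q12 mG' G'0 iG'.
change (is_true (meanable m2 A)) in iA; change (mean m2 A = mean PP G) in MA.
change (is_true (meanable m1 B)) in iB.
change (mean m1 B = mean (m2 \x m1) (fun w => G (w.2, w.1))) in MB.
change (is_true (meanable m2 (fun y => A y `^ q)%R)) in iAq.
change (is_true (meanable m1 (fun x => B x `^ q)%R)) in iBq.
change (is_true (meanable PP (fun z => A z.2 `^ (q - 1) * G z)%R)) in iAG.
change (mean PP (fun z => A z.2 `^ (q - 1) * G z)%R =
  mean m2 (fun y => A y `^ q)%R) in MAG.
change (is_true (meanable (m2 \x m1) (fun w => B w.2 `^ (q - 1) * G (w.2, w.1))%R)) in iBG.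
change (mean (m2 \x m1) (fun w => B w.2 `^ (q - 1) * G (w.2, w.1))%R =
  mean m1 (fun x => B x `^ q)%R) in MBG.
have A0 y : (0 <= A y)%R by exact: mean_ge0.
have B0 x : (0 <= B x)%R by exact: mean_ge0.
have mA : measurable_fun setT A by apply/measurable_EFinP; exact: measurable_int iA.
have mB : measurable_fun setT B by apply/measurable_EFinP; exact: measurable_int iB.
have mp (t : R) d (T : measurableType d) (u : T -> R) : measurable_fun setT u ->
  measurable_fun setT (fun x => u x `^ t)%R.
  by move=> mu; exact: (measurableT_comp (@measurable_powR R t)).
have mBG : measurable_fun setT (fun z => B z.1 `^ (q - 1) * G z)%R.
  by apply: measurable_funM => //; exact: (measurableT_comp (mp _ _ _ _ mB)).
have BG0 z : (0 <= B z.1 `^ (q - 1) * G z)%R by rewrite mulr_ge0 ?powR_ge0.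
rewrite (mean_swap mBG BG0) in MBG.
have {}iBG := (meanable_swap mBG BG0).2 iBG.
rewrite (mean_swap mG G0) in MB.
set M := mean PP G in MA MB *.
set al := mean m2 (fun y => A y `^ q)%R in MAG *.
set be := mean m1 (fun x => B x `^ q)%R in MBG *.
set g := mean PP (fun z => G z `^ q)%R.
have M0 : (0 <= M)%R by exact: mean_ge0.
have [iA2 MA2] := mean_snd m1 mA A0 iA.
have [iB1 MB1] := mean_fst m2 mB B0 iB.
have [iAq2 MAq2] := mean_snd m1 (mp q _ _ _ mA) (fun y => powR_ge0 _ _) iAq.
have [iBq1 MBq1] := mean_fst m2 (mp q _ _ _ mB) (fun y => powR_ge0 _ _) iBq.
have mAB : measurable_fun setT (fun z => A z.2 * B z.1)%R.
  by apply: measurable_funM; [exact: (measurableT_comp mA)|exact: (measurableT_comp mB)].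
have HAB : \int[PP]_z (A z.2 * B z.1)%:E = (M * M)%:E.
  rewrite (@fubini_tonelli2 _ _ _ _ _ m1 m2 (fun z => (A z.2 * B z.1)%:E)); last 2 first.
  - exact/measurable_EFinP.
  - by move=> z; rewrite lee_fin mulr_ge0.
  transitivity (\int[m2]_y (M%:E * (A y)%:E)).
    apply: eq_integral => y _; rewrite /fubini_G/=.
    under eq_integral do rewrite EFinM.
    rewrite ge0_integralZl//; [|exact/measurable_EFinP|by move=> ? _; rewrite lee_fin|by rewrite lee_fin].
    by rewrite mean_EFin// MB muleC.
  rewrite ge0_integralZl//; [|exact/measurable_EFinP|by move=> *; rewrite lee_fin].
  by rewrite mean_EFin// MA.
have iAB : meanable PP (fun z => A z.2 * B z.1)%R.
  by apply: meanable_fin => //; [move=> z; rewrite mulr_ge0|rewrite HAB ltry].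
have MAB : mean PP (fun z => A z.2 * B z.1)%R = (M * M)%R.
  by apply: EFin_inj; rewrite -mean_EFin.
(* The scaled four-point inequality, integrated: the mixed terms [A^(q-1) G] and [B^(q-1) G]
   integrate to [al] and [be], and [A B] to [M * M] by independence. At [m = M] it collapses to
   [al + be <= g + M^q]. *)
have main (m : R) : (0 < m)%R -> (q * al + q * be + q * (q - 1) * m `^ (q - 1) * M
    + q * (q - 1) * m `^ (q - 1) * M + (q - 1) * m `^ q <=
    g + (q - 1) * al + (q - 1) * be + q * m `^ (q - 1) * M
    + q * (q - 1) * m `^ (q - 2) * (M * M) + q * (q - 1) * m `^ q)%R.
  move=> m0.
  have j1 := meanableD (meanableZ q iAG) (meanableZ q iBG).
  have j2 := meanableD j1 (meanableZ (q * (q - 1) * m `^ (q - 1))%R iA2).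
  have j3 := meanableD j2 (meanableZ (q * (q - 1) * m `^ (q - 1))%R iB1).
  have j4 := meanableD j3 (meanable_cst PP ((q - 1) * m `^ q)%R).
  have k1 := meanableD iG (meanableZ (q - 1)%R iAq2).
  have k2 := meanableD k1 (meanableZ (q - 1)%R iBq1).
  have k3 := meanableD k2 (meanableZ (q * m `^ (q - 1))%R iGM).
  have k4 := meanableD k3 (meanableZ (q * (q - 1) * m `^ (q - 2))%R iAB).
  have k5 := meanableD k4 (meanable_cst PP (q * (q - 1) * m `^ q)%R).
  have := mean_le j4 k5
    (fun z => powR_four_point_scaled q12 m0 (G0 z) (A0 z.2) (B0 z.1)).
  rewrite (meanD j3 (meanable_cst _ _)) (meanD j2 (meanableZ _ iB1)).
  rewrite (meanD j1 (meanableZ _ iA2)) (meanD (meanableZ _ iAG) (meanableZ _ iBG)).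
  rewrite (meanD k4 (meanable_cst _ _)) (meanD k3 (meanableZ _ iAB)).
  rewrite (meanD k2 (meanableZ _ iGM)) (meanD k1 (meanableZ _ iBq1)).
  rewrite (meanD iG (meanableZ _ iAq2)).
  rewrite (meanZ _ iAG) (meanZ _ iBG) (meanZ _ iA2) (meanZ _ iB1) (meanZ _ iAq2).
  rewrite (meanZ _ iBq1) (meanZ _ iGM) (meanZ _ iAB) !mean_cst.
  by rewrite MAG MBG MA2 MA MB1 MB MAq2 MBq1 MAB.
clearbody al be g M; clear - main M0 q0 q1 q2.
(* If [M = 0], choosing [m^q = e] leaves an error [(q - 1)^2 e <= e], and [e] is arbitrary. *)
have [Mz|Mn0] := eqVneq M 0%R.
  apply/ler_addgt0Pr => e e0.
  have := main (e `^ q^-1)%R (powR_gt0 _ e0); clear main.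
  have eq : ((e `^ q^-1) `^ q = e)%R.
    by rewrite -powRrM mulVf ?gt_eqF// powRr1// ltW.
  rewrite eq Mz !mulr0 !addr0.
  rewrite (powR0 (lt0r_neq0 q0)) addr0.
  have : ((q - 1) ^+ 2 * e <= e)%R.
    by rewrite ler_piMl ?(ltW e0)//; nra.
  rewrite expr2; lra.
have Mp : (0 < M)%R by rewrite lt_neqAle eq_sym Mn0.
have := main M Mp; clear main.
have e1 : (M `^ (q - 1) * M = M `^ q)%R by rewrite mulrC mulr_powRB1.
have e2 : (M `^ (q - 2) * (M * M) = M `^ q)%R.
  have -> : (q - 2 = (q - 1) - 1)%R by ring.
  rewrite powRB; last by rewrite (gt_eqF Mp) implybT.
  by rewrite powRr1// -e1; field.
rewrite -!(mulrA _ (M `^ (q - 1))%R) -!(mulrA _ (M `^ (q - 2))%R) e1 e2; lra.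
Qed.

(** Each hypothesis, integrated over the other factor, bounds [g = E F^2] by the mean [q]-th power
    of a partial mean of [F^p] plus an energy. The sum of the two bounds [2 g], and subadditivity
    returns one [g] together with the desired power. The energies [e1] and [e2] may be infinite. *)
Lemma tensor_beckner (F : T1 * T2 -> R) (e1 e2 : T1 * T2 -> \bar R) (p : R) :
  (1 <= p < 2)%R -> measurable_fun setT F -> (forall z, (0 <= F z)%R) ->
  measurable_fun setT e1 -> (forall z, 0 <= e1 z) ->
  measurable_fun setT e2 -> (forall z, 0 <= e2 z) ->
  (forall y, \int[m1]_x (F (x, y) ^+ 2)%:E < +oo ->
    \int[m1]_x (F (x, y) ^+ 2)%:E <=
    (\int[m1]_x (F (x, y) `^ p)%:E) `^ (2 / p)%R + \int[m1]_x e1 (x, y)) ->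
  (forall x, \int[m2]_y (F (x, y) ^+ 2)%:E < +oo ->
    \int[m2]_y (F (x, y) ^+ 2)%:E <=
    (\int[m2]_y (F (x, y) `^ p)%:E) `^ (2 / p)%R + \int[m2]_y e2 (x, y)) ->
  \int[PP]_z (F z ^+ 2)%:E < +oo ->
  \int[PP]_z (F z ^+ 2)%:E <=
  (\int[PP]_z (F z `^ p)%:E) `^ (2 / p)%R + \int[PP]_z (e1 z + e2 z).
Proof.
move=> p12 mF F0 me1 e10 me2 e20 H1 H2 Foo.
have p0 : (0 < p)%R by lra.
have p12' : (1 <= p <= 2)%R by lra.
set q := (2 / p)%R in H1 H2 *.
have q12 : (1 < q <= 2)%R.
  by rewrite /q ltr_pdivlMr// ler_pdivrMr//; lra.
have mF2 : measurable_fun setT (fun z => F z ^+ 2)%R by exact: measurable_funX.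
have mFp : measurable_fun setT (fun z => F z `^ p)%R.
  exact: (measurableT_comp (@measurable_powR R p)).
have iF2 : meanable PP (fun z => F z ^+ 2)%R.
  by apply: meanable_fin => // z; exact: sqr_ge0.
have iFp := meanable_powR p12' mF F0 iF2.
have FpqE z : ((F z `^ p) `^ q = F z ^+ 2)%R.
  rewrite -powRrM /q mulrC divfK ?gt_eqF//; exact: powR_mulrn.
have iG : meanable PP (fun z => (F z `^ p) `^ q)%R.
  by under eq_fun do rewrite FpqE.
have T := tensor_powR q12 mFp (fun z => powR_ge0 _ _) iG.
have E20 z : 0 <= (F z ^+ 2)%:E by rewrite lee_fin sqr_ge0.
have mE2 : measurable_fun setT (fun z => (F z ^+ 2)%:E) by exact/measurable_EFinP.
have Ep0 z : 0 <= (F z `^ p)%:E by rewrite lee_fin powR_ge0.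
have mEp : measurable_fun setT (fun z => (F z `^ p)%:E) by exact/measurable_EFinP.
set g := mean PP (fun z => F z ^+ 2)%R.
have gE : \int[PP]_z (F z ^+ 2)%:E = g%:E by exact: mean_EFin.
have mFx y : measurable_fun setT (fun x => F (x, y)) by exact: (measurableT_comp mF).
have mFy x : measurable_fun setT (fun y => F (x, y)) by exact: (measurableT_comp mF).
have iA : meanable m2 (fun y => mean m1 (fun x => F (x, y) `^ p) `^ q)%R.
  exact: (@meanable_partial_powR _ _ _ _ _ m1 m2 (fun z => F z `^ p)%R).
have G1 : g%:E <= (mean m2 (fun y => mean m1 (fun x => F (x, y) `^ p) `^ q))%:E
    + \int[PP]_z e1 z.
  rewrite -gE fubini_tonelli2// (@fubini_tonelli2 _ _ _ _ _ m1 m2 e1)// -mean_EFin//.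
  rewrite -ge0_integralD//; last 4 first.
  - by move=> y _; rewrite lee_fin powR_ge0.
  - exact: measurable_int iA.
  - by move=> y _; apply: integral_ge0.
  - exact: measurable_fun_fubini_tonelli_G.
  apply: ae_ge0_le_integral => //.
  - by move=> y _; apply: integral_ge0.
  - exact: measurable_fun_fubini_tonelli_G.
  - by move=> y _; rewrite adde_ge0 ?lee_fin ?powR_ge0//; apply: integral_ge0.
  - apply: emeasurable_funD; first exact: measurable_int iA.
    exact: measurable_fun_fubini_tonelli_G.
  have i : m2.-integrable setT (fun y => \int[m1]_x (F (x, y) ^+ 2)%:E).
    apply/integrableP; split; first exact: (measurable_fun_fubini_tonelli_G _ mE2 E20).
    under eq_integral do rewrite gee0_abs ?integral_ge0//.
    by rewrite -(fubini_tonelli2 _ mE2 E20).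
  (* The one-factor inequality is available only on sections with finite second moment, which is
     almost all of them. *)
  have := integrable_ae measurableT i; apply: filterS => y /(_ Logic.I) h _.
  have yoo : \int[m1]_x (F (x, y) ^+ 2)%:E < +oo.
    by rewrite -ge0_fin_numE// integral_ge0.
  have i2 : meanable m1 (fun x => F (x, y) ^+ 2)%R.
    by apply: meanable_fin => //; [exact: measurable_funX|move=> x; exact: sqr_ge0].
  apply: (le_trans (H1 y yoo)).
  by rewrite (mean_EFin (meanable_powR p12' (mFx y) (fun x => F0 _) i2)) poweR_EFin.
have iB : meanable m1 (fun x => mean m2 (fun y => F (x, y) `^ p) `^ q)%R.
  have mFpq : measurable_fun setT (fun z => (F z `^ p) `^ q)%R.
    exact: (measurableT_comp (@measurable_powR R q)).
  have Fpq0 z : (0 <= (F z `^ p) `^ q)%R by exact: powR_ge0.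
  have iG' := (meanable_swap mFpq Fpq0).1 iG.
  exact: (meanable_partial_powR q12 (measurable_fun_swap mFp)
    (fun w => powR_ge0 _ _) iG').
have G2 : g%:E <= (mean m1 (fun x => mean m2 (fun y => F (x, y) `^ p) `^ q))%:E
    + \int[PP]_z e2 z.
  rewrite -gE fubini_tonelli1// (@fubini_tonelli1 _ _ _ _ _ m1 m2 e2)// -mean_EFin//.
  rewrite -ge0_integralD//; last 4 first.
  - by move=> y _; rewrite lee_fin powR_ge0.
  - exact: measurable_int iB.
  - by move=> y _; apply: integral_ge0.
  - exact: measurable_fun_fubini_tonelli_F.
  apply: ae_ge0_le_integral => //.
  - by move=> y _; apply: integral_ge0.
  - exact: measurable_fun_fubini_tonelli_F.
  - by move=> y _; rewrite adde_ge0 ?lee_fin ?powR_ge0//; apply: integral_ge0.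
  - apply: emeasurable_funD; first exact: measurable_int iB.
    exact: measurable_fun_fubini_tonelli_F.
  have i : m1.-integrable setT (fun x => \int[m2]_y (F (x, y) ^+ 2)%:E).
    apply/integrableP; split; first exact: (measurable_fun_fubini_tonelli_F _ mE2 E20).
    under eq_integral do rewrite gee0_abs ?integral_ge0//.
    by rewrite -(fubini_tonelli1 _ mE2 E20).
  have := integrable_ae measurableT i; apply: filterS => x /(_ Logic.I) h _.
  have xoo : \int[m2]_y (F (x, y) ^+ 2)%:E < +oo.
    by rewrite -ge0_fin_numE// integral_ge0.
  have i2 : meanable m2 (fun y => F (x, y) ^+ 2)%R.
    by apply: meanable_fin => //; [exact: measurable_funX|move=> y; exact: sqr_ge0].
  apply: (le_trans (H2 x xoo)).
  by rewrite (mean_EFin (meanable_powR p12' (mFy x) (fun x => F0 _) i2)) poweR_EFin.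
rewrite gE ge0_integralD// mean_EFin// poweR_EFin.
have gE' : mean PP (fun z => (F z `^ p) `^ q)%R = g.
  by rewrite /g; congr mean; apply/funext => z; rewrite FpqE.
rewrite gE' in T.
move: T G1 G2; set al := mean m2 _; set be := mean m1 _; set M := (mean PP _ `^ q)%R.
(* Cancelling the spare [g] uses its finiteness. *)
move=> T G1 G2; rewrite -(@leeD2lE _ g%:E)//.
apply: (le_trans (leeD G1 G2)); rewrite addeACA [leRHS]addeA leeD2r//.
Qed.

End tensorisation.

(** * The inequality on R^n *)

Section beckner_mu1.
Local Open Scope ereal_scope.
Context {R : realType}.

(** The extended form of the real inequality; if the energy is infinite, so is the right side, its
    coefficient being positive because [p < 2]. *)
Lemma beckner_mu1 (r a p : R) (r1 : (1 <= r)%R) (f df : R -> R) :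
  (r <= 2)%R -> (0 <= a <= 1)%R -> (r / 2 * a = r - 1)%R -> (1 <= p < 2)%R ->
  (forall x : R, is_derive x 1%R f (df x)) -> continuous df ->
  (forall x, 0 <= f x)%R ->
  \int[mu1 r1]_x (f x ^+ 2)%:E < +oo ->
  \int[mu1 r1]_x (f x ^+ 2)%:E <=
  (\int[mu1 r1]_x (f x `^ p)%:E) `^ (2 / p)%R +
  \int[mu1 r1]_x (beckner_cst * (2 - p) `^ a * df x ^+ 2)%:E.
Proof.
move=> r2 a01 ra p12 dfE cdf f0 foo.
have cf := is_derive_continuous dfE.
have mf : measurable_fun [set: measurableTypeR R] f by exact: continuous_measurable_fun.
have cdf2 : continuous (fun x => df x ^+ 2)%R by exact: continuous_sqr_comp.
have mdf2 : measurable_fun [set: measurableTypeR R] (fun x => df x ^+ 2)%R.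
  exact: continuous_measurable_fun.
have k0 : (0 < beckner_cst * (2 - p) `^ a :> R)%R.
  by rewrite mulr_gt0 ?beckner_cst_gt0// powR_gt0//; lra.
under [X in _ + X]eq_integral do rewrite EFinM.
rewrite ge0_integralZl; [|exact: measurableT|exact/measurable_EFinP|
  by move=> x _; rewrite lee_fin sqr_ge0|by rewrite lee_fin ltW].
have [dfoo|dfoo] := ltP (\int[mu1 r1]_x (df x ^+ 2)%:E) +oo; last first.
  move: dfoo; rewrite leye_eq => /eqP ->.
  rewrite gt0_muley ?lte_fin// addey ?leey//.
  by rewrite gt_eqF// (lt_le_trans _ (poweR_ge0 _ _)).
have if2 : meanable (mu1 r1) (fun x => f x ^+ 2)%R.
  by apply: meanable_fin => //; [exact: measurable_funX|move=> x; exact: sqr_ge0].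
have idf2 : meanable (mu1 r1) (fun x => df x ^+ 2)%R.
  by apply: meanable_fin => // x; exact: sqr_ge0.
have p12' : (1 <= p <= 2)%R by lra.
have ifp := meanable_powR p12' mf f0 if2.
rewrite (mean_EFin if2) (mean_EFin ifp) (mean_EFin idf2) poweR_EFin.
by rewrite -EFinM -EFinD lee_fin; exact: beckner_real.
Qed.

End beckner_mu1.

(** * Open sets and the coordinate sigma-algebra *)

Section rV_borel.
Context {R : realType} {n : nat}.
Implicit Types (x y : 'rV[R]_n) (f : 'rV[R]_n -> R).

Lemma ball_rVP x e y : 0 < e ->
  ball x e y <-> forall i, `|x ord0 i - y ord0 i| < e.
Proof.
move=> e0; split; first by case=> _ xy i; exact: xy.
by move=> xy; split=> // i j; rewrite !(ord1 i); exact: xy.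
Qed.

Let box (qk : 'rV[rat]_n * nat) : set 'rV[R]_n :=
  [set y | forall i, `|ratr (qk.1 ord0 i) - y ord0 i| < qk.2.+1%:R^-1].

Let measurable_box qk : measurable (box qk).
Proof.
rewrite (_ : box qk = \bigcap_(i in setT)
    ((fun x : 'rV[R]_n => x ord0 i) @^-1`
      [set t | `|ratr (qk.1 ord0 i) - t| < qk.2.+1%:R^-1])); last first.
  by apply/seteqP; split => [y Hy i _|y Hy i]; exact: Hy.
apply: fin_bigcap_measurable => [|i _]; first exact: finite_finset.
have := @measurable_coord_rV R n i measurableT
  [set t | `|ratr (qk.1 ord0 i) - t| < qk.2.+1%:R^-1].
rewrite setTI; apply; apply: open_measurable.
exact: (@ball_open R R^o (ratr (qk.1 ord0 i)) (qk.2.+1%:R^-1)).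
Qed.

(** An open set is the union of the boxes with rational centre and radius [1/(k+1)] that it
    contains; there are countably many, and each is a finite intersection of coordinate
    conditions. *)
Lemma open_measurable_rV (U : set 'rV[R]_n) : open U -> measurable U.
Proof.
move=> oU.
have -> : U = \bigcup_(qk in [set qk | box qk `<=` U]) box qk.
  apply/seteqP; split=> [x Ux|x [qk /= qkU]]; last exact: qkU.
  have /nbhs_ballP[e/= e0 xeU] : nbhs x U by exact: open_nbhs_nbhs.
  (* The factor 2 pays for the two steps of the triangle inequality through the rational centre. *)
  have [k ke] : exists k : nat, 2 * k.+1%:R^-1 <= e.
    exists (Num.truncn (2 / e)); rewrite mulrC ler_pdivrMl ?ltr0n//.
    by rewrite -ler_pdivrMr// ltW// truncnS_gt.
  have k0 : 0 < k.+1%:R^-1 :> R by rewrite invr_gt0 ltr0n.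
  have /choice[q qx] : forall i, exists q : rat, `|ratr q - x ord0 i| < k.+1%:R^-1.
    move=> i; have : x ord0 i - k.+1%:R^-1 < x ord0 i + k.+1%:R^-1.
      by rewrite ltrD2l (lt_trans _ k0)// oppr_lt0.
   
    move=> /rat_in_itvoo[q]; rewrite in_itv/= => qi; exists q.
    by rewrite ltr_distl.
  exists (\row_i q i, k) => [y /= Hy|i /=]; last by rewrite mxE.
  apply: xeU; apply/ball_rVP => // i; have := Hy i; rewrite mxE => yi.
  rewrite (le_lt_trans (ler_distD (ratr (q i)) _ _))//.
  by rewrite (lt_le_trans _ ke)// mulr_natl mulr2n ltrD// distrC.
rewrite bigcup_mkcond; apply: countable_bigcupT_measurable => // qk.
by case: ifP.
Qed.

Lemma continuous_measurable_rV f : continuous f ->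
  measurable_fun setT (f : 'rV[R]_n -> measurableTypeR R).
Proof.
move=> cf; apply: (measurability _ (RGenOInfty.measurableE R)).
move=> /= _ [_ [a ->]] <-; apply: measurableI => //; apply: open_measurable_rV.
by move/continuousP : cf; apply; exact: interval_open.
Qed.

End rV_borel.

(** * The product measure and its splitting *)

Section mu_rV.
Context {R : realType}.

Lemma integral_lebesgue_rVS n (F : 'rV[R]_n.+1 -> \bar R) :
  measurable_fun setT F -> (forall x, (0 <= F x)%E) ->
  (\int[lebesgue_rV n.+1]_x F x =
   \int[(@lebesgue_measure R) \x (lebesgue_rV n)]_z F (cons_rV z))%E.
Proof.
move=> mF F0.
by rewrite (@ge0_integral_pushforward _ _ _ _ _ _ (@measurable_cons_rV R n)).
Qed.

Definition rdens n (r : R) (x : 'rV[R]_n) : R :=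
  c_r r ^+ n * expR (- \sum_(i < n) `|x ord0 i| `^ r).

Lemma rdens_ge0 n (r : R) (x : 'rV[R]_n) : 1 <= r -> 0 <= rdens r x.
Proof. by move=> r1; rewrite mulr_ge0 ?expR_ge0// exprn_ge0// ltW// c_r_gt0. Qed.

Lemma measurable_rdens n (r : R) : measurable_fun setT (@rdens n r).
Proof.
apply: measurable_funM => //; apply: measurableT_comp => //.
apply: measurableT_comp => //; apply: measurable_sum => i.
apply: (measurableT_comp (@measurable_powR R r)).
apply: measurableT_comp => //; exact: measurable_coord_rV.
Qed.

Lemma rdens_cons n (r : R) (z : measurableTypeR R * 'rV[R]_n) :
  rdens r (cons_rV z) = gdens r z.1 * rdens r z.2.
Proof.
rewrite /rdens /gdens big_ord_recl cons_rV0 opprD expRD exprS mulrACA.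
by congr (_ * (_ * expR (- _))); apply: eq_bigr => i _; rewrite cons_rVS.
Qed.

Lemma integral_rdens n (r : R) : 1 <= r ->
  (\int[lebesgue_rV n]_x (rdens r x)%:E = 1)%E.
Proof.
move=> r1; elim: n => [|n IH].
  rewrite integral_dirac//; last by apply/measurable_EFinP; exact: measurable_rdens.
  rewrite diracE mem_set// mul1e /rdens expr0 big_ord0 oppr0 expR0.
  by rewrite mulr1.
rewrite integral_lebesgue_rVS; last 2 first.
- by apply/measurable_EFinP; exact: measurable_rdens.
- by move=> x; rewrite lee_fin rdens_ge0.
under eq_integral do rewrite rdens_cons EFinM.
have mg : measurable_fun setT (fun x : measurableTypeR R => (gdens r x)%:E).
  by apply/measurable_EFinP; exact: measurable_gdens.
have md : measurable_fun setT (fun x : 'rV[R]_n => (rdens r x)%:E).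
  by apply/measurable_EFinP; exact: measurable_rdens.
rewrite (@fubini_tonelli1 _ _ _ _ _ _ _
  (fun z : measurableTypeR R * 'rV[R]_n => ((gdens r z.1)%:E * (rdens r z.2)%:E)%E)); last 2 first.
- by apply: emeasurable_funM; [exact: (measurableT_comp mg)|exact: (measurableT_comp md)].
- by move=> z; rewrite mule_ge0 ?lee_fin ?gdens_ge0 ?rdens_ge0.
transitivity (\int[lebesgue_measure]_x (gdens r x)%:E)%E; last exact: integral_gdens.
apply: eq_integral => x _; rewrite /fubini_F/= ge0_integralZl//.
- by rewrite IH mule1.
- by move=> y _; rewrite lee_fin rdens_ge0.
- by rewrite lee_fin gdens_ge0.
Qed.

Definition mu_rV n (r : R) (r1 : 1 <= r) : probability 'rV[R]_n R :=
  density_prob (@measurable_rdens n r) (fun x => @rdens_ge0 n r x r1)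
    (integral_rdens n r1).

(** Lebesgue measure on the larger space is the image of a product by construction, and the density
    factorises, so the first coordinate is independent of the others. *)
Lemma integral_mu_rVS n (r : R) (r1 : 1 <= r) (F : 'rV[R]_n.+1 -> \bar R) :
  measurable_fun setT F -> (forall x, (0 <= F x)%E) ->
  (\int[mu_rV n.+1 r1]_x F x = \int[(mu1 r1) \x (mu_rV n r1)]_z F (cons_rV z))%E.
Proof.
move=> mF F0.
have mFc : measurable_fun setT (fun z : measurableTypeR R * 'rV[R]_n => F (cons_rV z)).
  exact: (measurableT_comp mF (@measurable_cons_rV R n)).
have md m : measurable_fun setT (fun x : 'rV[R]_m => (rdens r x)%:E).
  by apply/measurable_EFinP; exact: measurable_rdens.
have mg : measurable_fun setT (fun x : measurableTypeR R => (gdens r x)%:E).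
  by apply/measurable_EFinP; exact: measurable_gdens.
rewrite integral_density_prob// integral_lebesgue_rVS; last 2 first.
- by apply: emeasurable_funM => //; exact: md.
- by move=> x; rewrite mule_ge0// lee_fin rdens_ge0.
rewrite fubini_tonelli1; last 2 first.
- apply: emeasurable_funM => //.
  exact: (measurableT_comp (md n.+1) (@measurable_cons_rV R n)).
- by move=> z; rewrite mule_ge0// lee_fin rdens_ge0.
rewrite (@fubini_tonelli1 _ _ _ _ _ (mu1 r1) (mu_rV n r1))//.
rewrite integral_density_prob//; last 2 first.
- exact: (@measurable_fun_fubini_tonelli_F _ _ _ _ _ (mu_rV n r1)).
- by move=> x; apply: integral_ge0.
apply: eq_integral => x _; rewrite /fubini_F/=.
have mFx : measurable_fun setT (fun y : 'rV[R]_n => F (cons_rV (x, y))).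
  by exact: (measurableT_comp mFc).
rewrite integral_density_prob// -ge0_integralZr//.
- by apply: eq_integral => y _; rewrite rdens_cons EFinM/= muleAC muleA.
- by apply: emeasurable_funM => //; exact: md.
- by move=> y _; rewrite mule_ge0// lee_fin rdens_ge0.
- by rewrite lee_fin gdens_ge0.
Qed.

End mu_rV.

(** * Sections of continuously differentiable functions *)

Section C1_rV.
Context {R : realType}.

(** First-order regularity is all that the induction on dimension carries along, and it passes to
    sections with a fixed first coordinate. *)
Definition C1_rV n (f : 'rV[R]_n -> R) : Prop :=
  [/\ continuous f, forall i x, derivable f x (delta_mx ord0 i)
    & forall i, continuous (partial i f)].

Lemma smooth_C1 n (f : 'rV[R]_n -> R) : smooth f -> C1_rV f.
Proof.
move=> sf; have [cf df] := sf [::]; split=> // i.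
by have [] := sf [:: i].
Qed.

Lemma sqr_enorm_gradient n (f : 'rV[R]_n -> R) x :
  enorm (gradient f x) ^+ 2 = \sum_(i < n) partial i f x ^+ 2.
Proof.
rewrite /enorm sqr_sqrtr; last by apply: sumr_ge0 => i _; exact: sqr_ge0.
by apply: eq_bigr => i _; rewrite mxE.
Qed.

Lemma measurable_sqr_gradient n (f : 'rV[R]_n -> R) : C1_rV f ->
  measurable_fun setT (fun x => enorm (gradient f x) ^+ 2).
Proof.
move=> [_ _ cdf]; under eq_fun do rewrite sqr_enorm_gradient.
apply: measurable_sum => i; apply: measurable_funX.
exact: continuous_measurable_rV.
Qed.

Lemma cons_rVD n (t h : R) (y v : 'rV[R]_n) (w : 'rV[R]_n.+1) (k : R) :
  w ord0 ord0 = k -> (forall i, w ord0 (lift ord0 i) = v ord0 i) ->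
  cons_rV (h * k + t, h *: v + y) = h *: w + cons_rV (t, y).
Proof.
move=> w0 wS; apply/rowP => j; case: (unliftP ord0 j) => [i ->|->].
  by rewrite cons_rVS [RHS]mxE cons_rVS [X in _ = X + _]mxE wS !mxE.
by rewrite cons_rV0 [RHS]mxE cons_rV0 [X in _ = X + _]mxE w0.
Qed.

Lemma cons_rV_delta0 n (t h : R) (y : 'rV[R]_n) :
  cons_rV (h *: 1 + t, y) = h *: delta_mx ord0 ord0 + cons_rV (t, y).
Proof.
have := @cons_rVD n t h y 0 (delta_mx ord0 ord0) 1.
by rewrite scaler0 add0r; apply=> [|i]; rewrite !mxE.
Qed.

Lemma cons_rV_deltaS n (t h : R) (y : 'rV[R]_n) (i : 'I_n) :
  cons_rV (t, h *: delta_mx ord0 i + y) =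
  h *: delta_mx ord0 (lift ord0 i) + cons_rV (t, y).
Proof.
have := @cons_rVD n t h y (delta_mx ord0 i) (delta_mx ord0 (lift ord0 i)) 0.
rewrite mulr0 add0r; apply=> [|j]; rewrite !mxE//.
Qed.

Lemma continuous_cons_rVr n (t : R) :
  continuous (fun y : 'rV[R]_n => cons_rV (t, y) : 'rV[R]_n.+1).
Proof.
move=> y P /nbhs_ballP[e /= e0 eP]; apply/nbhs_ballP; exists e => //= z yz.
apply: eP; apply/ball_rVP => // j; case: (unliftP ord0 j) => [i ->|->].
  by rewrite !cons_rVS; move/ball_rVP: yz; exact.
by rewrite !cons_rV0 subrr normr0.
Qed.

Lemma continuous_cons_rVl n (y : 'rV[R]_n) :
  continuous (fun t : R => cons_rV (t, y) : 'rV[R]_n.+1).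
Proof.
move=> t P /nbhs_ballP[e /= e0 eP]; apply/nbhs_ballP; exists e => //= s ts.
apply: eP; apply/ball_rVP => // j; case: (unliftP ord0 j) => [i ->|->].
  by rewrite !cons_rVS subrr normr0.
by rewrite !cons_rV0.
Qed.

Context n (f : 'rV[R]_n.+1 -> R) (C1f : C1_rV f).

(** The difference quotient of the section is literally that of [f] in the first coordinate
    direction; the same holds for the other directions below. *)
Lemma is_derive_section0 (y : 'rV[R]_n) (t : R) :
  is_derive t 1 (fun s : R => f (cons_rV (s, y))) (partial ord0 f (cons_rV (t, y))).
Proof.
case: C1f => _ df _; have := df ord0 (cons_rV (t, y)).
rewrite /derivable /partial /derive.
set q := (X in cvg (X @ _)) => cq.
have qE : q = (fun h => h^-1 *: (((fun s : R => f (cons_rV (s, y))) \o shift t) (h *: (1 : R^o))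
    - f (cons_rV (t, y)))).
  by apply/funext => h; rewrite /q /= cons_rV_delta0.
by split; rewrite /derivable /derive -qE.
Qed.

Lemma partial_section (t : R) (i : 'I_n) :
  partial i (fun y => f (cons_rV (t, y))) =
  (fun y => partial (lift ord0 i) f (cons_rV (t, y))).
Proof.
apply/funext => y; rewrite /partial /derive.
set q := (X in lim (X @ _) = _); set q' := (X in _ = lim (X @ _)).
suff -> : q = q' by [].
by apply/funext => h; rewrite /q /q' /= cons_rV_deltaS.
Qed.

Lemma C1_section (t : R) : C1_rV (fun y => f (cons_rV (t, y))).
Proof.
case: C1f => cf df cdf; split.
- move=> y; apply: (@continuous_comp _ _ _ (fun y => cons_rV (t, y)) f).
    exact: continuous_cons_rVr.
  exact: cf.
- move=> i y; have := df (lift ord0 i) (cons_rV (t, y)); rewrite /derivable.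
  set q := (X in cvg (X @ _) -> _); set q' := (X in _ -> cvg (X @ _)).
  suff -> : q = q' by [].
  by apply/funext => h; rewrite /q /q' /= cons_rV_deltaS.
- move=> i; rewrite partial_section => y.
  apply: (@continuous_comp _ _ _ (fun y => cons_rV (t, y))).
    exact: continuous_cons_rVr.
  exact: cdf.
Qed.

Lemma continuous_section0 (y : 'rV[R]_n) :
  continuous (fun t : R => partial ord0 f (cons_rV (t, y))).
Proof.
case: C1f => _ _ cdf t; apply: (@continuous_comp _ _ _ (fun t : R => cons_rV (t, y))).
  exact: continuous_cons_rVl.
exact: cdf.
Qed.

End C1_rV.

Section beckner_rV.
Local Open Scope ereal_scope.
Context {R : realType}.

Lemma beckner_rV (r a p : R) (r1 : (1 <= r)%R) n (f : 'rV[R]_n -> R) :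
  (r <= 2)%R -> (0 <= a <= 1)%R -> (r / 2 * a = r - 1)%R -> (1 <= p < 2)%R ->
  C1_rV f -> (forall x, 0 <= f x)%R ->
  \int[mu_rV n r1]_x (f x ^+ 2)%:E < +oo ->
  \int[mu_rV n r1]_x (f x ^+ 2)%:E <=
  (\int[mu_rV n r1]_x (f x `^ p)%:E) `^ (2 / p)%R +
  \int[mu_rV n r1]_x (beckner_cst * (2 - p) `^ a * enorm (gradient f x) ^+ 2)%:E.
Proof.
move=> r2 a01 ra p12.
have p0 : (0 < p)%R by lra.
have k0 : (0 <= beckner_cst * (2 - p) `^ a :> R)%R.
  by rewrite mulr_ge0 ?powR_ge0// ltW// beckner_cst_gt0.
elim: n f => [|n IH] f C1f f0 foo.
  (* The space [R^0] is a point: [f] is constant and its entropy is 0. *)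
  have fE : f = cst (f (0 : 'rV[R]_0)%R) by apply/funext => x; rewrite (thinmx0 x).
  rewrite fE/= integral_cst_prob integral_cst_prob poweR_EFin -powRrM mulrC divfK ?gt_eqF//.
  rewrite powR_mulrn// leeDl// integral_ge0// => x _.
  by rewrite lee_fin mulr_ge0// sqr_ge0.
have [cf _ cdf] := C1f.
have mf := continuous_measurable_rV cf.
have mfc : measurable_fun setT (fun z : measurableTypeR R * 'rV[R]_n => f (cons_rV z)).
  exact: (measurableT_comp mf (@measurable_cons_rV R n)).
have mg := measurable_sqr_gradient C1f.
have mf2 : measurable_fun setT (fun x => (f x ^+ 2)%:E).
  by apply/measurable_EFinP; exact: measurable_funX.
have mfpE : measurable_fun setT (fun x => (f x `^ p)%:E).
  by apply/measurable_EFinP; exact: (measurableT_comp (@measurable_powR R p)).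
have mgE : measurable_fun setT
    (fun x => (beckner_cst * (2 - p) `^ a * enorm (gradient f x) ^+ 2)%:E).
  by apply/measurable_EFinP; exact: measurable_funM.
pose e1 (z : measurableTypeR R * 'rV[R]_n) :=
  (beckner_cst * (2 - p) `^ a * partial ord0 f (cons_rV z) ^+ 2)%:E.
pose e2 (z : measurableTypeR R * 'rV[R]_n) := (beckner_cst * (2 - p) `^ a *
  \sum_(i < n) partial (lift ord0 i) f (cons_rV z) ^+ 2)%:E.
have md i : measurable_fun setT
    (fun z : measurableTypeR R * 'rV[R]_n => partial i f (cons_rV z) ^+ 2)%R.
  apply: measurable_funX.
  exact: (measurableT_comp (continuous_measurable_rV (cdf i)) (@measurable_cons_rV R n)).
have f20 x : 0 <= (f x ^+ 2)%:E by rewrite lee_fin sqr_ge0.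
have fp0 x : 0 <= (f x `^ p)%:E by rewrite lee_fin powR_ge0.
have g0 x : 0 <= (beckner_cst * (2 - p) `^ a * enorm (gradient f x) ^+ 2)%:E.
  by rewrite lee_fin mulr_ge0// sqr_ge0.
rewrite (integral_mu_rVS r1 mf2 f20) in foo *.
rewrite (integral_mu_rVS r1 mfpE fp0) (integral_mu_rVS r1 mgE g0).
have -> : \int[mu1 r1 \x mu_rV n r1]_z
    (beckner_cst * (2 - p) `^ a * enorm (gradient f (cons_rV z)) ^+ 2)%:E =
  \int[mu1 r1 \x mu_rV n r1]_z (e1 z + e2 z).
  apply: eq_integral => z _; rewrite sqr_enorm_gradient big_ord_recl.
  by rewrite mulrDr EFinD.
apply: (tensor_beckner (F := fun z => f (cons_rV z))) => //.
- by apply/measurable_EFinP; exact: measurable_funM.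
- by move=> z; rewrite lee_fin mulr_ge0// sqr_ge0.
- apply/measurable_EFinP; apply: measurable_funM => //; exact: measurable_sum.
- by move=> z; rewrite lee_fin mulr_ge0// sumr_ge0// => i _; exact: sqr_ge0.
- move=> y yoo.
  exact: (beckner_mu1 r2 a01 ra p12 (is_derive_section0 C1f y)
    (continuous_section0 C1f (y:=y)) (fun x => f0 _) yoo).
- move=> x xoo; have := IH _ (C1_section C1f x) (fun y => f0 _) xoo.
  move/le_trans; apply; rewrite leeD2l//.
  rewrite le_eqVlt; apply/orP; left; apply/eqP; apply: eq_integral => y _.
  rewrite /e2 sqr_enorm_gradient; congr (_ * _)%:E; apply: eq_bigr => i _.
  by rewrite partial_section.
Qed.

End beckner_rV.

Theorem theorem2 (R : realType) :
  exists2 C : R, 0 < C &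
  forall (n : nat) (a r : R),
    (1 <= n)%N -> 0 <= a <= 1 -> 1 <= r <= 2 -> r = 2 / (2 - a) ->
    c_r r = r / (2 * Gamma r^-1) /\
    exists2 P : probability 'rV[R]_n R,
      (forall A : set 'rV[R]_n, measurable A -> P A = mu_r r A) &
      forall (f : 'rV[R]_n -> R) (p : R),
        smooth f -> (forall x, 0 <= f x) ->
        P.-integrable setT (fun x => (f x ^+ 2)%:E) ->
        1 <= p < 2 ->
        ('E_P[(fun x => f x ^+ 2)%R] - 'E_P[(fun x => f x `^ p)%R] `^ (2 / p)%R
         <= (C * (2 - p) `^ a)%:E
            * 'E_P[(fun x => enorm (gradient f x) ^+ 2)%R])%E.
Proof.
exists beckner_cst; first exact: beckner_cst_gt0.
move=> n a r _ a01 /andP[r1 r2] rE; split; first exact: c_rE.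
(* [mu_rV] and [mu_r] unfold to the same integral, so the agreement on measurable sets is
   immediate. *)
exists (mu_rV n r1) => // f p sf f0 if2 p12.
have a2 : 2 - a != 0 by rewrite gt_eqF//; lra.
have ra : r / 2 * a = r - 1 by rewrite rE; field.
have C1f := smooth_C1 sf.
have foo : (\int[mu_rV n r1]_x (f x ^+ 2)%:E < +oo)%E.
  by rewrite (mean_EFin if2) ltry.
have mf := continuous_measurable_rV (let: And3 cf _ _ := C1f in cf).
have p12' : 1 <= p <= 2 by lra.
have ifp := meanable_powR p12' mf f0 if2.
have H := beckner_rV r2 a01 ra p12 C1f f0 foo.
(* Moving the subtracted power to the right uses its finiteness, which follows from square
   integrability of [f]. *)
rewrite unlock leeBlDr; last by rewrite (mean_EFin ifp) poweR_EFin.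
rewrite addeC -ge0_integralZl//.
- by apply/measurable_EFinP; exact: measurable_sqr_gradient.
- by move=> x _; rewrite lee_fin sqr_ge0.
- by rewrite lee_fin mulr_ge0 ?powR_ge0// ltW// beckner_cst_gt0.
Qed.
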